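(* Let $H\subseteq\mathcal F_{25}$ and $0\le p\le q\le\infty$. For arbitrary nonempty terms $u,v$, $$\mathcal U(H,p,q)\models u\approx v\quad\Longleftrightarrow\quad C_{H,p,q}(u)=C_{H,p,q}(v).$$ For a monomial $w$, equivalently, $$\mathcal U(H,p,q)\models w\preceq v\quad\Longleftrightarrow\quad C_{H,p,q}(v)=0\ \text{ or }\ w\in C_{H,p,q}(v).$$
   Context: A commutative ai-semiring is an algebra $(S,+,\cdot)$ (two binary operations, no constants) in which both operations are associative and commutative, $x+x\approx x$, and multiplication distributes over addition. $u\preceq v$ abbreviates $u+v\approx v$. Modulo these axioms a term is a finite nonempty set (sum) of commutative monomials. The semiring $R_{12}$: its universe is $\{0,c,p,q,a,b\}$ (letters used as elements only in this paragraph); the only nonzero products are $pb=bp=ab=ba=aq=qa=c$; addition is the join of the partial order generated by $a<p<0$, $b<q<0$, $c<0$, $a<c$, $b<q<c$. Let $\mathcal V=\mathsf V(R_{12})$ be the variety it generates. For a set $E$ of identities, $\mathcal V[E]$ is the subvariety of $\mathcal V$ defined by adjoining $E$. In $\mathcal V$ all squares are equal and additively greatest; $0$ denotes this common value. Abbreviations: $C(t,u)=t+tu$, $D(t,u)=t+u+tu$, $L(a,b,c,d)=ab+bc+cd$ (now $a,b,c,d,\dots$ are variables). $\mathcal F_{25}$ consists of the 25 identities: $\rho: x\preceq xy$; $\eta: z\preceq x+xy+yz$; $\omega: y\preceq x+xy$; $\zeta: z\preceq C(x,y)+zt$; $\lambda: z\preceq D(x,y)+xz$; $\eta_D: z\preceq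 x+xy+yz+D(t,u)$; $\omega_D: y\preceq C(x,y)+D(t,u)$; $\zeta_D: z\preceq D(x,y)+zt$; $\mu: ad\preceq b+L(a,b,c,d)$; $\nu: ad\preceq C(t,u)+L(a,b,c,d)$; $\mu_2: ad\preceq b+c+L(a,b,c,d)$; $\mu_D: ad\preceq b+L(a,b,c,d)+D(t,u)$; $\nu_D: ad\preceq L(a,b,c,d)+D(t,u)$; $\delta: ad\preceq L(a,b,c,d)$; $\xi: x^2\approx D(x,y)$; $\beta: xz\preceq C(x,y)+C(t,z)$; $s: x^2\approx C(x,y)$; $\chi: x^2\approx xy$; $\tau: x\approx y$; $\alpha: ad\preceq a+L(a,b,c,d)$; $\alpha_D: ad\preceq a+L(a,b,c,d)+D(t,u)$; $\varepsilon: ad\preceq a+b+c+L(a,b,c,d)$; $\kappa: ad\preceq a+b+L(a,b,c,d)$; $\iota_2: x_0x_5\preceq x_1+\sum_{j=0}^4x_jx_{j+1}$; $\iota_2^D: x_0x_5\preceq x_1+\sum_{j=0}^4x_jx_{j+1}+D(t,u)$. Each $f\in\mathcal F_{25}$ is read as an absorption $q_f\preceq v_f$: the square identities $\xi,s,\chi$ are read as $0\preceq v_f$ with $v_f=D(x,y),C(x,y),xy$ respectively, and $\tau$ as $y\preceq x$. For $n\ge1$: $$\gamma_n:\ x_0y\preceq x_0+x_{2n}+\sum_{j=0}^{2n-1}x_jx_{j+1}+x_{2n}y,\qquad \gamma_n^D:\ x_0y\preceq x_0+x_{2n}+\sum_{j=0}^{2n-1}x_jx_{j+1}+x_{2n}y+D(t,u).$$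 For $H\subseteq\mathcal F_{25}$, $0\le p\le q\le\infty$: $\mathcal U(H,p,q)=\mathcal V[H,\ \gamma_i:1\le i\le p,\ \gamma_j^D:1\le j\le q]$ (threshold $0$ gives an empty family, $\infty$ the whole family). Graph of a term $v$: $M(v)$ is the set of variables occurring as linear summands; $G(v)$ has as edges the square-free quadratic summands, and as vertices only the variables incident with an edge; $W(v)=M(v)\cap V(G(v))$ is the set of marked vertices. A term is basic-zero if it contains a square, a monomial of degree at least three, or if $G(v)$ has an odd cycle; otherwise $G(v)$ is bipartite. A component of $G(v)$ (bipartite case) is a D-component if both of its bipartition classes contain marked vertices. Environment rule: a basic-zero term becomes $0$; otherwise add all edges between marked vertices lying in opposite bipartition classes of the same component. Closure $C_{H,p,q}(v)$: if $\tau\in H$, all terms have the same normal form, namely $0$. If $\tau\notin H$, $C_{H,p,q}(v)$ is the least extension of the environment normal form of $v$ (a set of monomials in the variables of $v$, or $0$) closed under: (1) for each $f\in H$ and each map of the variables of $v_f$ into the variables of the term (identifications allowed), include the image of $q_f$ whenever all image summands of $v_f$ are present; a square query is interpreted as $0$ and its insertion sends the result to $0$; (2) let $k=p$ if the (current) term has no D-component and $k=q$ otherwise; for any two marked vertices $x,x'$ in the same component and the same bipartition class at distance at most $2k$, join $x$ to every neighbour of $x'$ (for $k=\infty$ only the same component and class are required); (3) reapply the environment rule: a square or odd cycle gives $0$; otherwise add all edges between marks in opposite classes of the same component. *)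

(* Defs.v *)
From HB Require Import structures.
From mathcomp Require Import all_boot.
From mathcomp Require Import finmap multiset.
From mathcomp Require Import boolp classical_sets.

Set Implicit Arguments.
Unset Strict Implicit.
Unset Printing Implicit Defensive.

Local Open Scope fset_scope.

Record aiSemiring : Type := AiSemiring {
  car :> Type;
  add : car -> car -> car;
  mul : car -> car -> car;
  addA : associative add;
  addC : commutative add;
  addxx : idempotent_op add;
  mulA : associative mul;
  mulC : commutative mul;
  mulDr : right_distributive mul add }.

Definition is_hom (A B : aiSemiring) (f : A -> B) : Prop :=
  {morph f : x y / add x y} /\ {morph f : x y / mul x y}.

Section Product.
Variables (I : Type) (F : I -> aiSemiring).
Let T := forall i, F i.
Let padd (x y : T) : T := fun i => add (x i) (y i).
Let pmul (x y : T) : T := fun i => mul (x i) (y i).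

Lemma prod_addA : associative padd.
Proof.
by move=> x y z; apply: functional_extensionality_dep => i; apply: addA.
Qed.
Lemma prod_addC : commutative padd.
Proof.
by move=> x y; apply: functional_extensionality_dep => i; apply: addC.
Qed.
Lemma prod_addxx : idempotent_op padd.
Proof.
by move=> x; apply: functional_extensionality_dep => i; apply: addxx.
Qed.
Lemma prod_mulA : associative pmul.
Proof.
by move=> x y z; apply: functional_extensionality_dep => i; apply: mulA.
Qed.
Lemma prod_mulC : commutative pmul.
Proof.
by move=> x y; apply: functional_extensionality_dep => i; apply: mulC.
Qed.
Lemma prod_mulDr : right_distributive pmul padd.
Proof.
by move=> x y z; apply: functional_extensionality_dep => i; apply: mulDr.
Qed.

Definition prodS : aiSemiring :=
  AiSemiring prod_addA prod_addC prod_addxx prod_mulA prod_mulC prod_mulDr.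
End Product.

(* The least class containing R and closed under homomorphic images,
   subalgebras (up to isomorphism) and products.  Empty carriers are not
   excluded: they satisfy every identity. *)
Inductive variety (R : aiSemiring) : aiSemiring -> Prop :=
| variety_gen : variety R R
| variety_hom (A B : aiSemiring) (f : A -> B) :
    is_hom f -> (forall b, exists a, f a = b) -> variety R A -> variety R B
| variety_sub (A B : aiSemiring) (f : B -> A) :
    is_hom f -> injective f -> variety R A -> variety R B
| variety_prod (I : Type) (F : I -> aiSemiring) :
    (forall i, variety R (F i)) -> variety R (prodS F).

Inductive term : Type :=
| Var of nat
| Add of term & term
| Mul of term & term.

Declare Scope term_scope.
Delimit Scope term_scope with term.
Bind Scope term_scope with term.
Notation "s + t" := (Add s t) : term_scope.
Notation "s * t" := (Mul s t) : term_scope.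

Fixpoint eval (A : aiSemiring) (e : nat -> A) (t : term) : A :=
  match t with
  | Var i => e i
  | Add s t => add (eval e s) (eval e t)
  | Mul s t => mul (eval e s) (eval e t)
  end.

Definition sat (A : aiSemiring) (i : term * term) : Prop :=
  forall e : nat -> A, eval e i.1 = eval e i.2.

Definition models (K : aiSemiring -> Prop) (i : term * term) : Prop :=
  forall A, K A -> sat A i.

Definition below (u v : term) : term * term := ((u + v)%term, v).

Fixpoint rename (s : nat -> nat) (t : term) : term :=
  match t with
  | Var i => Var (s i)
  | Add t1 t2 => Add (rename s t1) (rename s t2)
  | Mul t1 t2 => Mul (rename s t1) (rename s t2)
  end.

Notation mon := ({mset nat}%mset).

(* A term modulo the ai-semiring axioms is its set of monomials. *)
Fixpoint mons (t : term) : {fset mon} :=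
  match t with
  | Var i => [fset [mset i]%mset]
  | Add s t => mons s `|` mons t
  | Mul s t => [fset (m `+` n)%mset | m in mons s, n in mons t]
  end.

Inductive r12 : Set := R0 | Rc | Rp | Rq | Ra | Rb.

Definition r12_mul (x y : r12) : r12 :=
  match x, y with
  | Rp, Rb | Rb, Rp | Ra, Rb | Rb, Ra | Ra, Rq | Rq, Ra => Rc
  | _, _ => R0
  end.

Definition r12_add (x y : r12) : r12 :=
  match x, y with
  | Rc, Rc | Rc, Rq | Rc, Ra | Rc, Rb | Rq, Rc | Ra, Rc | Rb, Rc
  | Rq, Ra | Ra, Rq | Ra, Rb | Rb, Ra => Rc
  | Rp, Rp | Rp, Ra | Ra, Rp => Rp
  | Rq, Rq | Rq, Rb | Rb, Rq => Rq
  | Ra, Ra => Ra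
  | Rb, Rb => Rb
  | _, _ => R0
  end.

Inductive r12_le : r12 -> r12 -> Prop :=
| r12_le_refl x : r12_le x x
| r12_le_trans y x z : r12_le x y -> r12_le y z -> r12_le x z
| r12_le_ap : r12_le Ra Rp
| r12_le_p0 : r12_le Rp R0
| r12_le_bq : r12_le Rb Rq
| r12_le_q0 : r12_le Rq R0
| r12_le_c0 : r12_le Rc R0
| r12_le_ac : r12_le Ra Rc
| r12_le_qc : r12_le Rq Rc.

Lemma r12_leE x y : r12_le x y <-> r12_add x y = y.
Proof.
split; first by elim=> // {x y} [[]|[] [] []].
by case: x; case: y => //= _; do ?[by constructor];
   first [apply: (@r12_le_trans Rp); by constructor
         |apply: (@r12_le_trans Rq); by constructor].
Qed.

Lemma r12_add_join x y z :
  r12_le (r12_add x y) z <-> r12_le x z /\ r12_le y z.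
Proof.
by rewrite !r12_leE; case: x; case: y; case: z; split=> //=; case.
Qed.

Lemma r12_addA : associative r12_add. Proof. by do 3!case. Qed.
Lemma r12_addC : commutative r12_add. Proof. by do 2!case. Qed.
Lemma r12_addxx : idempotent_op r12_add. Proof. by case. Qed.
Lemma r12_mulA : associative r12_mul. Proof. by do 3!case. Qed.
Lemma r12_mulC : commutative r12_mul. Proof. by do 2!case. Qed.
Lemma r12_mulDr : right_distributive r12_mul r12_add.
Proof. by do 3!case. Qed.

Definition R12 : aiSemiring :=
  AiSemiring r12_addA r12_addC r12_addxx r12_mulA r12_mulC r12_mulDr.

Section Identities.
Local Open Scope term_scope.

Definition tC (t u : term) := t + t * u.
Definition tD (t u : term) := t + u + t * u.
Definition tL (a b c d : term) := a * b + b * c + c * d.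

Inductive F25 : Set :=
| f_rho | f_eta | f_omega | f_zeta | f_lambda
| f_etaD | f_omegaD | f_zetaD
| f_mu | f_nu | f_mu2 | f_muD | f_nuD | f_delta
| f_xi | f_beta | f_s | f_chi | f_tau
| f_alpha | f_alphaD | f_epsilon | f_kappa | f_iota2 | f_iota2D.

Local Notation x0 := (Var 0).
Local Notation x1 := (Var 1).
Local Notation x2 := (Var 2).
Local Notation x3 := (Var 3).
Local Notation x4 := (Var 4).
Local Notation x5 := (Var 5).
Local Notation x := (Var 6).
Local Notation y := (Var 7).
Local Notation z := (Var 8).
Local Notation t := (Var 9).
Local Notation u := (Var 10).
Local Notation a := (Var 11).
Local Notation b := (Var 12).
Local Notation c := (Var 13).
Local Notation d := (Var 14).

(* [absorbed f] and [absorber f] are q_f and v_f in the reading q_f <= v_f.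
   The zero query of f_xi, f_s and f_chi is represented by the square of x. *)
Definition absorbed (f : F25) : term :=
  match f with
  | f_rho => x
  | f_eta | f_zeta | f_lambda | f_etaD | f_zetaD => z
  | f_omega | f_omegaD | f_tau => y
  | f_mu | f_nu | f_mu2 | f_muD | f_nuD | f_delta
  | f_alpha | f_alphaD | f_epsilon | f_kappa => a * d
  | f_xi | f_s | f_chi => x * x
  | f_beta => x * z
  | f_iota2 | f_iota2D => x0 * x5
  end.

Local Notation path5 := (x0 * x1 + x1 * x2 + x2 * x3 + x3 * x4 + x4 * x5).

Definition absorber (f : F25) : term :=
  match f with
  | f_rho => x * y
  | f_eta => x + x * y + y * z
  | f_omega => x + x * y
  | f_zeta => tC x y + z * t
  | f_lambda => tD x y + x * z
  | f_etaD => x + x * y + y * z + tD t u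
  | f_omegaD => tC x y + tD t u
  | f_zetaD => tD x y + z * t
  | f_mu => b + tL a b c d
  | f_nu => tC t u + tL a b c d
  | f_mu2 => b + c + tL a b c d
  | f_muD => b + tL a b c d + tD t u
  | f_nuD => tL a b c d + tD t u
  | f_delta => tL a b c d
  | f_xi => tD x y
  | f_beta => tC x y + tC t z
  | f_s => tC x y
  | f_chi => x * y
  | f_tau => x
  | f_alpha => a + tL a b c d
  | f_alphaD => a + tL a b c d + tD t u
  | f_epsilon => a + b + c + tL a b c d
  | f_kappa => a + b + tL a b c d
  | f_iota2 => x1 + path5
  | f_iota2D => x1 + path5 + tD t u
  end.

Definition identity (f : F25) : term * term :=
  match f with
  | f_xi => (x * x, tD x y)
  | f_s => (x * x, tC x y)
  | f_chi => (x * x, x * y)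
  | f_tau => (x, y)
  | _ => below (absorbed f) (absorber f)
  end.

(* The letters y, t, u of gamma_n are the variables 2n+1, 2n+2, 2n+3. *)
Definition gamma_rhs (n : nat) : term :=
  foldl Add (Var 0)
    (Var (2 * n)%N :: [seq Var j * Var j.+1 | j <- iota 0 (2 * n)]
       ++ [:: Var (2 * n)%N * Var (2 * n).+1]).

Definition gamma (n : nat) : term * term :=
  below (Var 0 * Var (2 * n).+1) (gamma_rhs n).

Definition gammaD (n : nat) : term * term :=
  below (Var 0 * Var (2 * n).+1)
        (gamma_rhs n + tD (Var (2 * n).+2) (Var (2 * n).+3)).

End Identities.

(* Thresholds in the extended natural numbers; [None] is infinity. *)
Definition threshold := option nat.

Definition nat_le_thr (n : nat) (p : threshold) : bool :=
  if p is Some k then n <= k else true.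

Definition thr_le (p q : threshold) : bool :=
  match p, q with
  | _, None => true
  | None, Some _ => false
  | Some i, Some j => i <= j
  end.

Definition subvariety (H : pred F25) (p q : threshold) (A : aiSemiring) : Prop
  :=
  [/\ variety R12 A,
      forall f, H f -> sat A (identity f),
      forall i, 1 <= i -> nat_le_thr i p -> sat A (gamma i) &
      forall j, 1 <= j -> nat_le_thr j q -> sat A (gammaD j)].

Section Graph.
Variable X : {fset mon}.

Definition vars : {fset nat} := [fset i | m in X, i in finsupp m].

Definition edge : rel nat := fun x y => (x != y) && ([mset x; y]%mset \in X).

Definition marked (x : nat) : Prop := [mset x]%mset \in X /\ exists y, edge x y.

Definition odd_cycle : Prop :=
  exists c : seq nat, ucycle edge c /\ odd (size c).

Definition basic_zero : Prop :=
  [\/ exists x, [mset x; x]%mset \in X,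
      exists2 m : mon, m \in X & 3 <= size m |
      odd_cycle].

(* In a bipartite graph, two vertices of a component lie in the same (resp.
   opposite) bipartition classes when a walk of even (resp. odd) length
   joins them. *)
Definition same_class (x y : nat) : Prop :=
  exists w, [/\ path edge x w, last x w = y & ~~ odd (size w)].

Definition opp_class (x y : nat) : Prop :=
  exists w, [/\ path edge x w, last x w = y & odd (size w)].

Definition dist_le_double (k : threshold) (x y : nat) : Prop :=
  exists w, [/\ path edge x w, last x w = y &
                if k is Some k then size w <= 2 * k else true].

Definition has_D_component : Prop :=
  exists x y, [/\ marked x, marked y & opp_class x y].

End Graph.

(* [None] is the normal form 0. *)
Definition nf := option {fset mon}.

Definition nf_le (M N : nf) : Prop :=
  match M, N with
  | _, None => True
  | None, Some _ => False
  | Some X, Some T => X `<=` T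
  end.

Definition env (X : {fset mon}) : nf :=
  if `[< basic_zero X >] then None else
  Some (X `|` [fset [mset x; y]%mset | x in vars X, y in vars X &
                 `[< [/\ marked X x, marked X y & opp_class X x y] >]]).

Section Closure.
Variables (H : pred F25) (p q : threshold).

(* A square among the renamed queries makes X basic-zero, which [closed_env]
   forbids; so a zero query, too, sends the closure to 0. *)
Definition closed_rules (X : {fset mon}) : Prop :=
  forall f (s : nat -> nat), H f ->
    mons (rename s (absorber f)) `<=` X -> mons (rename s (absorbed f)) `<=` X.

Definition closed_dist (X : {fset mon}) : Prop :=
  let k := if `[< has_D_component X >] then q else p in
  forall x x' y, marked X x -> marked X x' -> same_class X x x' ->
    dist_le_double X k x x' -> edge X x' y -> [mset x; y]%mset \in X.

Definition closed_env (X : {fset mon}) : Prop := env X = Some X.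

Definition closed_nf (N : nf) : Prop :=
  if N is Some X then [/\ closed_rules X, closed_dist X & closed_env X]
  else True.

Definition closed_ext (v : {fset mon}) (N : nf) : Prop :=
  [/\ if N is Some X then vars X `<=` vars v else True,
      nf_le (env v) N & closed_nf N].

Definition least_closed_ext (v : {fset mon}) (N : nf) : Prop :=
  closed_ext v N /\ forall N', closed_ext v N' -> nf_le N N'.

(* [xget] selects the least closed extension, which exists by
   [least_closed_ext_exists] and is unique by [least_closed_ext_uniq]. *)
Definition nform (v : term) : nf :=
  if H f_tau then None else xget None (least_closed_ext (mons v)).

End Closure.

Lemma nf_le_anti M N : nf_le M N -> nf_le N M -> M = N.
Proof.
case: M N => [X|] [T|] //= XT TS.
by congr Some; apply/eqP; rewrite eqEfsubset XT TS.
Qed.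

Lemma least_closed_ext_uniq H p q v M N :
  least_closed_ext H p q v M -> least_closed_ext H p q v N -> M = N.
Proof. by case=> cM lM [cN lN]; apply: nf_le_anti; [apply: lM | apply: lN]. Qed.

Section Monotony.
Variables (X T : {fset mon}).
Hypothesis XT : X `<=` T.

Lemma edge_mono : subrel (edge X) (edge T).
Proof. by move=> x y /andP[nxy /(fsubsetP XT) xyT]; apply/andP. Qed.

Lemma marked_mono x : marked X x -> marked T x.
Proof.
by case=> /(fsubsetP XT) xT [y /edge_mono xy]; split=> //; exists y.
Qed.

Lemma same_class_mono x y : same_class X x y -> same_class T x y.
Proof.
case=> w [pw ? ?]; exists w; split=> //.
exact: sub_path edge_mono _ _ pw.
Qed.

Lemma opp_class_mono x y : opp_class X x y -> opp_class T x y.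
Proof.
case=> w [pw ? ?]; exists w; split=> //.
exact: sub_path edge_mono _ _ pw.
Qed.

Lemma dist_mono k l x y :
  thr_le k l -> dist_le_double X k x y -> dist_le_double T l x y.
Proof.
move=> kl [w [pw lw sw]]; exists w; split=> //.
  exact: sub_path edge_mono _ _ pw.
case: l k kl sw => [l|] // [k|] //= kl /leq_trans; apply.
by rewrite leq_mul2l kl.
Qed.

Lemma basic_zero_mono : basic_zero X -> basic_zero T.
Proof.
case=> [[x /(fsubsetP XT)]|[m /(fsubsetP XT)]|[c [/andP[cc uc] oc]]] *.
- by apply: Or31; exists x.
- by apply: Or32; exists m.
apply: Or33; exists c; split=> //; apply/andP; split=> //.
exact: sub_cycle edge_mono _ cc.
Qed.

Lemma vars_mono : vars X `<=` vars T.
Proof.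
apply/fsubsetP=> i /imfset2P[m /= /(fsubsetP XT) mT [j /= jm ->]].
by apply/imfset2P; exists m => //; exists j.
Qed.
End Monotony.

Lemma thr_le_refl p : thr_le p p.
Proof. by case: p => /=. Qed.

Lemma closed_envP X : closed_env X <-> ~ basic_zero X /\
  forall x y, marked X x -> marked X y -> opp_class X x y ->
    [mset x; y]%mset \in X.
Proof.
have mv x : marked X x -> x \in vars X.
  by case=> xS _; apply/imfset2P; exists [mset x]%mset => //; exists x => //;
     rewrite /= mem_finsupp msetnxx.
rewrite /closed_env /env; case: asboolP => [z|nz]; first by split=> // -[].
split=> [[E]|[_ E]].
  split=> // x y mx my oxy; rewrite -E in_fsetU; apply/orP; right.
  apply/imfset2P; exists x; first exact: mv.
  by exists y => //; rewrite inE mv //=; apply/asboolP.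
congr Some; apply/fsetUidPl/fsubsetP=> m /imfset2P[x _ [y]].
by rewrite inE => /andP[_ /asboolP[]] mx my oxy ->; apply: E.
Qed.

Lemma least_closed_ext_exists H p q v :
  thr_le p q -> exists N, least_closed_ext H p q v N.
Proof.
move=> pq.
have [[T0 T0ok]|none] := pselect (exists T, closed_ext H p q v (Some T));
  last first.
  exists None; split; first by split=> //; case: (env v).
  by case=> // T Tok; case: none; exists T.
pose I := [fset m in T0 |
  `[< forall T, closed_ext H p q v (Some T) -> m \in T >]].
have mI m : m \in I <-> forall T, closed_ext H p q v (Some T) -> m \in T.
  rewrite !inE /=; split=> [/andP[_ /asboolP]//|mT].
  by apply/andP; split; [exact: mT | exact/asboolP].
have IT T : closed_ext H p q v (Some T) -> I `<=` T.
  by move=> Tok; apply/fsubsetP=> m /mI; apply.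
exists (Some I); split; last by case=> //= T; exact: IT.
split.
- by case: (T0ok) => T0v _ _; apply: fsubset_trans T0v; apply/vars_mono/IT.
- case: (T0ok) => _ /=; case Ev: (env v) => [X|] //= _ _.
  apply/fsubsetP=> m mS; apply/mI => T [_ + _].
  by rewrite Ev => /fsubsetP; apply.
split.
- move=> f s Hf sub; apply/fsubsetP=> m mq; apply/mI=> T Tok.
  case: (Tok) => _ _ [rT _ _]; apply: (fsubsetP (rT _ _ Hf _)) mq.
  exact: fsubset_trans (IT _ Tok).
- rewrite /closed_dist; set k := (if _ then q else p).
  move=> x x' y mx mx' sxx' dxx' ex'y; apply/mI=> T Tok.
  case: (Tok) => _ _ [_ dT _].
  have sub := IT _ Tok.
  apply: (dT x x' y); [exact: marked_mono mx | exact: marked_mono mx'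
    | exact: same_class_mono sxx' | | exact: edge_mono ex'y].
  apply: dist_mono dxx' => //; rewrite /k.
  case: asboolP => [[a [b [ma mb ab]]]|_];
    last by case: ifP; rewrite ?thr_le_refl.
  case: asboolP => [_|[]]; first exact: thr_le_refl.
  by exists a, b; split; [exact: marked_mono ma | exact: marked_mono mb
    | exact: opp_class_mono ab].
apply/closed_envP; split.
  case: (T0ok) => _ _ [_ _ /closed_envP[nz _]] zI.
  by apply: nz; apply: basic_zero_mono zI; exact: IT.
move=> x y mx my oxy; apply/mI=> T Tok; have sub := IT _ Tok.
case: (Tok) => _ _ [_ _ /closed_envP[_]]; apply;
  [exact: marked_mono mx | exact: marked_mono my | exact: opp_class_mono oxy].
Qed.

Lemma nformP H p q v : thr_le p q -> ~~ H f_tau ->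
  least_closed_ext H p q (mons v) (nform H p q v).
Proof.
move=> pq /negbTE nt; rewrite /nform nt.
by case: xgetP => // none;
  case: (least_closed_ext_exists H (mons v) pq) => N /none.
Qed.

(* Main.v *)
(** Soundness: over a member of the subvariety, the monomials lying below [v]
    form a closed extension of [v], so they contain the least one.

    Completeness: the terms modulo equality of normal forms are the
    countermodel. They form a member of the variety of [R12] by Birkhoff's
    argument, once the identities of [R12] are known to be those of the
    environment rule: a monomial outside the environment normal form is
    refuted by evaluating one bipartition class to [Ra] and the other to [Rb],
    with at most one vertex changed to [Rp] and one to [Rq]. They satisfy the
    adjoined identities under substitution of arbitrary terms, and not only of
    variables, because every variable of an absorbing term occurs in a
    product: unless the result is zero, it is replaced by a sum of variables,
    and each monomial of the substituted query comes from a choice of one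
    variable in each sum. *)

From HB Require Import structures.
Require Import Defs.
From mathcomp Require Import all_boot finmap multiset.
From mathcomp Require Import boolp zify.
Import Defs.

Set Implicit Arguments.
Unset Strict Implicit.
Unset Printing Implicit Defensive.

Local Open Scope fset_scope.

(** * Small multisets and the monomials of a term *)

Lemma perm_msetD (m n : mon) : perm_eq (m `+` n)%mset (m ++ n).
Proof.
apply/allP => i _ /=.
by rewrite count_cat !count_mem_mset msetE2.
Qed.

Lemma size_msetD (m n : mon) : size (m `+` n)%mset = (size m + size n)%N.
Proof. by rewrite (perm_size (perm_msetD m n)) size_cat. Qed.

Lemma size_mset1 (i : nat) : size [mset i]%mset = 1.
Proof. by rewrite enum_msetn. Qed.

Lemma size_mset2 (i j : nat) : size [mset i; j]%mset = 2.
Proof. by rewrite size_msetD !size_mset1. Qed.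

Lemma mset_size_cons (m : mon) : 0 < size m ->
  exists i (n : mon), m = (i +` n)%mset /\ size m = (size n).+1.
Proof.
have := seq_mset_id m; case: (enum_mset m) => [//|i s] <- _.
exists i, (seq_mset s); rewrite mset_cons; split=> //=.
by rewrite (perm_size (perm_eq_seq_mset s)).
Qed.

Lemma mset_size1 (m : mon) : size m = 1 -> exists i, m = [mset i]%mset.
Proof.
move=> s1; have := seq_mset_id m.
case: (enum_mset m) s1 => [|i [|]] // _ <-; exists i.
by apply/msetP => k; rewrite mset_seqE msetnE /= addn0 eq_sym; case: eqP.
Qed.

Lemma mset_size2 (m : mon) : size m = 2 -> exists i j, m = [mset i; j]%mset.
Proof.
move=> s2; case: (@mset_size_cons m) => [|i [n [Em E]]]; first by rewrite s2.
by case: (@mset_size1 n) => [|j En]; [rewrite s2 in E; case: E | exists i, j;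
  rewrite Em En].
Qed.

Lemma mset2C (i j : nat) : [mset i; j]%mset = [mset j; i]%mset.
Proof. exact: msetDC. Qed.

Lemma mons_var i (m : mon) : (m \in mons (Var i)) = (m == [mset i]%mset).
Proof. exact: in_fset1. Qed.

Lemma mons_add s t (m : mon) :
  (m \in mons (Add s t)) = (m \in mons s) || (m \in mons t).
Proof. exact: in_fsetU. Qed.

Lemma mons_mulP s t (m : mon) : m \in mons (Mul s t) <->
  exists n1 n2, [/\ n1 \in mons s, n2 \in mons t & m = (n1 `+` n2)%mset].
Proof.
split=> [/imfset2P[n1 /= n1s [n2 n2t ->]]|[n1 [n2 [n1s n2t ->]]]].
  by exists n1, n2.
by apply/imfset2P; exists n1 => //; exists n2.
Qed.

Lemma mem_mul s t (n1 n2 : mon) :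
  n1 \in mons s -> n2 \in mons t -> (n1 `+` n2)%mset \in mons (Mul s t).
Proof. by move=> *; apply/mons_mulP; exists n1, n2. Qed.

Lemma mons_mulVV i j : mons (Mul (Var i) (Var j)) = [fset [mset i; j]%mset].
Proof.
apply/fsetP => m; rewrite in_fset1; apply/idP/eqP => [/mons_mulP|->].
  by case=> n1 [n2 []]; rewrite !mons_var => /eqP-> /eqP->.
by apply: mem_mul; rewrite mons_var.
Qed.

Lemma mons_size t (m : mon) : m \in mons t -> 0 < size m.
Proof.
elim: t m => [i|s IHs t IHt|s IHs t IHt] m.
- by rewrite mons_var => /eqP->; rewrite size_mset1.
- by rewrite mons_add => /orP[/IHs|/IHt].
by case/mons_mulP=> n1 [n2 [/IHs n1_gt0 _ ->]];
  rewrite size_msetD addn_gt0 n1_gt0.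
Qed.

Lemma mons_neq0 t : exists m, m \in mons t.
Proof.
elim: t => [i|s [m ms] t _|s [m ms] t [n nt]].
- by exists [mset i]%mset; rewrite mons_var.
- by exists m; rewrite mons_add ms.
by exists (m `+` n)%mset; apply: mem_mul.
Qed.

(** Terms have no unit, so exactly the nonempty monomials are represented; this allows a statement
    about one monomial to be read as an identity. *)
Lemma ex_mon_term (m : mon) : 0 < size m -> exists t, mons t = [fset m].
Proof.
move E: (size m) => n; elim: n m E => // n IH m E _.
have [|i [m' [Em Es]]] := @mset_size_cons m; first by rewrite E.
have [m'0|m'_gt0] := posnP (size m').
  by have [|j ->] := @mset_size1 m; [rewrite Es m'0 | exists (Var j)].
case: (IH m') => [||t Et]; first by move: Es; rewrite E => -[].
  by move: m'_gt0 Es; rewrite E => + [->].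
exists (Mul (Var i) t); apply/fsetP => k; rewrite in_fset1;
  apply/idP/eqP => [|->].
  by case/mons_mulP=> n1 [n2 []];
    rewrite mons_var Et in_fset1 Em => /eqP-> /eqP-> ->.
by rewrite Em; apply: mem_mul; rewrite ?mons_var ?Et ?in_fset1.
Qed.

(** Lets a finite set of monomials built by closure arguments be evaluated again as a term. *)
Lemma ex_term (X : {fset mon}) : (exists m, m \in X) ->
  (forall m : mon, m \in X -> 0 < size m) -> exists t, mons t = X.
Proof.
have key (r : seq mon) m0 : 0 < size (m0 : mon) ->
    (forall m : mon, m \in r -> 0 < size m) ->
    exists t, forall m, m \in mons t = (m \in m0 :: r).
  move=> m0_gt0; elim: r => [|m r IH] pos.
    by have [t Et] := ex_mon_term m0_gt0; exists t => m;
      rewrite Et in_fset1 mem_seq1.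
  have [|t Et] := IH; first by move=> n nr; apply: pos; rewrite in_cons nr orbT.
  have [|s Es] := @ex_mon_term m; first by apply: pos; rewrite in_cons eqxx.
  exists (Add s t) => n; rewrite mons_add Es Et in_fset1 !in_cons.
  by case: (n == m); case: (n == m0).
case=> m0 m0X pos; have [||t Et] := key (X : seq mon) m0.
- exact: pos.
- by move=> m; apply: pos.
exists t; apply/fsetP => m; rewrite Et in_cons.
by case: eqP => // ->; rewrite m0X.
Qed.

(** * The order of a semiring and the evaluation of monomials *)

Definition sle (A : aiSemiring) (x y : A) := add x y = y.

Section Semantics.
Variable A : aiSemiring.
Implicit Types x y z : A.

Lemma sle_refl x : sle x x. Proof. exact: addxx. Qed.

Lemma sle_trans y x z : sle x y -> sle y z -> sle x z.
Proof. by rewrite /sle => xy yz; rewrite -yz addA xy. Qed.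

Lemma sle_anti x y : sle x y -> sle y x -> x = y.
Proof. by rewrite /sle => xy; rewrite addC xy. Qed.

Lemma sle_addE x y z : sle (add x y) z <-> sle x z /\ sle y z.
Proof.
rewrite /sle; split=> [E|[xz yz]]; last by rewrite -addA yz xz.
split; first by rewrite -E !addA addxx.
by rewrite -E addA [add y _]addC -!addA [add y _]addA addxx.
Qed.

Lemma sle_below e u v : eval e (below u v).1 = eval e (below u v).2 <->
  sle (eval e u) (eval e v : A).
Proof. by []. Qed.

(* A unit [None] is adjoined to the multiplication, so that a monomial can be
   evaluated by an iterated product. *)
Definition mulo (x y : option A) : option A :=
  match x, y with
  | Some a, Some b => Some (mul a b)
  | Some _, None => x
  | None, _ => y
  end.

Lemma muloA : associative mulo.
Proof. by move=> [x|] [y|] [z|] //=; rewrite mulA. Qed.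

Lemma muloC : commutative mulo.
Proof. by move=> [x|] [y|] //=; rewrite mulC. Qed.

Lemma mul1o : left_id None mulo. Proof. by case. Qed.

HB.instance Definition _ := Monoid.isComLaw.Build (option A) None mulo
  muloA muloC mul1o.

Definition evalm (e : nat -> A) (m : mon) : option A :=
  \big[mulo/None]_(i <- m) Some (e i).

Lemma evalmD e m n : evalm e (m `+` n)%mset = mulo (evalm e m) (evalm e n).
Proof. by rewrite /evalm (perm_big _ (perm_msetD m n)) big_cat. Qed.

Lemma evalm1 e i : evalm e [mset i]%mset = Some (e i).
Proof. by rewrite /evalm enum_msetn big_seq1. Qed.

Lemma evalm2 e i j : evalm e [mset i; j]%mset = Some (mul (e i) (e j)).
Proof. by rewrite evalmD !evalm1. Qed.

Definition ole (x : option A) (y : A) : Prop := if x is Some a then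
  sle a y else False.

Lemma ole_trans y (x : option A) z : ole x y -> sle y z -> ole x z.
Proof. by case: x => //= x; apply: sle_trans. Qed.

(* Multiplying by an arbitrary [z] makes the induction on products work. *)
Lemma ole_eval_mul e t (z : option A) a :
  ole (mulo z (Some (eval e t))) a <->
  forall m, m \in mons t -> ole (mulo z (evalm e m)) a.
Proof.
elim: t z => [i|s IHs t IHt|s IHs t IHt] z /=.
- split=> [h m|h]; first by rewrite mons_var => /eqP->; rewrite evalm1.
  by rewrite -evalm1; apply: h; rewrite mons_var.
- have -> : ole (mulo z (Some (add (eval e s) (eval e t)))) a <->
      ole (mulo z (Some (eval e s))) a /\ ole (mulo z (Some (eval e t))) a.
    by case: z => [z|] /=; rewrite ?mulDr sle_addE.
  rewrite IHs IHt; split=> [[hs ht] m|h].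
    by rewrite mons_add => /orP[/hs|/ht].
  by split=> m mt; apply: h; rewrite mons_add mt ?orbT.
have -> : Some (mul (eval e s) (eval e t)) =
  mulo (Some (eval e t)) (Some (eval e s)) by rewrite muloC.
rewrite muloA IHs; split=> [h m|h m ms].
  case/mons_mulP=> n1 [n2 [n1s n2t ->]]; rewrite evalmD muloA.
  move: (h _ n1s); rewrite -muloA [mulo (Some _) _]muloC muloA IHt.
  by apply.
rewrite -muloA [mulo (Some _) _]muloC muloA IHt => n nt.
by rewrite -muloA -evalmD; apply: h; apply: mem_mul.
Qed.

Lemma eval_leP e t a :
  sle (eval e t) a <-> forall m, m \in mons t -> ole (evalm e m) a.
Proof.
have -> : sle (eval e t) a <-> ole (mulo None (Some (eval e t))) a by [].
rewrite ole_eval_mul.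
by split=> h m /h; rewrite mul1o.
Qed.

Lemma evalm_le e t m : m \in mons t -> ole (evalm e m) (eval e t).
Proof. by move: m; apply/eval_leP/sle_refl. Qed.

Lemma eval_mons e s t : mons s = mons t -> eval e s = eval e t :> A.
Proof.
move=> st; apply: sle_anti; apply/eval_leP => m ms; apply: evalm_le.
  by rewrite -st.
by rewrite st.
Qed.

Lemma eval_mon_leP e w m a :
  mons w = [fset m] -> sle (eval e w) a <-> ole (evalm e m) a.
Proof.
move=> Ew; rewrite eval_leP; split=> [h|h n]; first by apply: h;
  rewrite Ew in_fset1.
by rewrite Ew in_fset1 => /eqP->.
Qed.

Lemma evalm_Some e (m : mon) : 0 < size m -> exists a, evalm e m = Some a.
Proof.
case/mset_size_cons=> i [n [-> _]]; rewrite evalmD evalm1.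
by case: (evalm e n) => [b|]; [exists (mul (e i) b) | exists (e i)].
Qed.

End Semantics.

Lemma variety_sat (R A : aiSemiring) (i : term * term) :
  variety R A -> sat R i -> sat A i.
Proof.
move=> vA Ri; elim: vA => // {A}.
- move=> A B f [fD fM] fsurj _ Ai e.
  (* Surjectivity and choice lift the valuation in [B] to one in [A]. *)
  have [g gK] := choice (fun k => fsurj (e k)).
  have fev t : eval e t = f (eval g t).
    by elim: t => [k|s IHs t IHt|s IHs t IHt] /=; rewrite ?gK ?fD ?fM ?IHs ?IHt.
  by rewrite !fev Ai.
- move=> A B f [fD fM] finj _ Ai e.
  have fev t : f (eval e t) = eval (f \o e) t.
    by elim: t => [k|s IHs t IHt|s IHs t IHt] //=; rewrite ?fD ?fM ?IHs ?IHt.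
  by apply: finj; rewrite !fev.
move=> I F _ Fi e; apply: functional_extensionality_dep => j.
have fev t : (eval e t : prodS F) j = eval (fun k => (e k : prodS F) j) t.
  by elim: t => [k|s IHs t IHt|s IHs t IHt] //=; rewrite -?IHs -?IHt.
by have := Fi j (fun k => (e k : prodS F) j); rewrite -!fev.
Qed.

(** * Walks, odd cycles and two-colourings *)

Lemma not_uniq_split (T : eqType) (w : seq T) : ~~ uniq w ->
  exists a w1 w2 w3, w = w1 ++ a :: w2 ++ a :: w3.
Proof.
elim: w => //= x w IH; rewrite negb_and negbK => /orP[/splitPr[w1 w2]|/IH].
  by exists x, [::], w1, w2.
by case=> a [w1 [w2 [w3 ->]]]; exists a, (x :: w1), w2, w3.
Qed.

Section Walks.
Variable X : {fset mon}.

(** The parity is a parameter: [false] is the same class, [true] the opposite class, and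
    concatenation adds parities by exclusive or. *)
Definition walk (b : bool) (x y : nat) : Prop :=
  exists w, [/\ path (edge X) x w, last x w = y & odd (size w) = b].

Lemma same_classE x y : same_class X x y <-> walk false x y.
Proof. split=> -[w [pw lw ow]]; exists w; split=> //;
  [exact: negbTE | exact: negbT]. Qed.

Lemma edgeC x y : edge X x y = edge X y x.
Proof. by rewrite /edge eq_sym mset2C. Qed.

Lemma edge_walk x y : edge X x y -> walk true x y.
Proof. by move=> xy; exists [:: y]; rewrite /= xy. Qed.

Lemma walk_refl x : walk false x x.
Proof. by exists [::]. Qed.

Lemma walk_trans y b c x z : walk b x y -> walk c y z -> walk (b (+) c) x z.
Proof.
move=> [w1 [p1 l1 <-]] [w2 [p2 l2 <-]]; exists (w1 ++ w2).
by rewrite cat_path last_cat l1 p1 size_cat oddD.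
Qed.

Lemma walk_sym b x y : walk b x y -> walk b y x.
Proof.
case=> w [pw <- sw]; exists (rev (belast x w)); split.
- by rewrite rev_path (eq_path (e' := edge X)) // => i j; rewrite edgeC.
- by case: w {pw sw} => //= a w; rewrite rev_cons last_rcons.
by rewrite size_rev size_belast.
Qed.

Lemma walk_edge x y : walk true x y -> exists z, edge X x z.
Proof. by case=> -[|z w] [] //= /andP[xz _] _ _; exists z. Qed.

(* A shortest odd closed walk is a cycle: cut at a repeated vertex, it splits
   into two shorter closed walks, one of which is odd. *)
Lemma odd_walk_cycle x : walk true x x -> odd_cycle X.
Proof.
case=> w [pw lw ow]; have [n] := ubnP (size w).
elim: n x w pw lw ow => // n IH x w pw lw ow sw.
have [uw|/not_uniq_split[a [w1 [w2 [w3 Ew]]]]] := boolP (uniq w).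
  case/lastP: w pw lw ow uw {sw} => // w y pw.
  rewrite last_rcons size_rcons => Eyx ow uw.
  exists (x :: w); split=> //; apply/andP; split; first by rewrite /= -{2}Eyx.
  by rewrite /= -rcons_uniq -Eyx.
move: pw lw ow sw; rewrite {w}Ew cat_path last_cat /= cat_path last_cat /=.
case/and5P=> p1 ea p2 ea' p3 l3.
rewrite !size_cat /= !size_cat /= => ow sw.
have [o2|e2] := boolP (odd (size w2)).
  apply: (IH x (w1 ++ a :: w3)).
  - by rewrite cat_path /= p1 ea.
  - by rewrite last_cat.
  - by move: ow; rewrite size_cat /= !(oddD, oddS) /= o2; case: odd; case: odd.
  by rewrite size_cat /=; lia.
apply: (IH a (rcons w2 a)).
- by rewrite rcons_path p2.
- by rewrite last_rcons.
- by rewrite size_rcons.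
by rewrite size_rcons; lia.
Qed.

(** Each component is coloured by the parity of walks from a root, which is well defined without odd
    cycles, and can be flipped on its own: the component of [y] is normalised at [y], every other
    one at [x]. If [x] and [y] are connected, the absence of an odd walk makes their colours
    agree. *)
Lemma ex_coloring x y : ~ odd_cycle X -> ~ walk true x y ->
  exists col : nat -> bool,
    [/\ forall i j, edge X i j -> col i = ~~ col j, col x & col y].
Proof.
move=> noc nxy.
have no_odd b i j : walk b i j -> walk (~~ b) i j -> False.
  move=> wb wnb; apply: noc; apply: (@odd_walk_cycle i).
  by have := walk_trans wb (walk_sym wnb); rewrite addbN addbb.
pose conn i j := `[< exists b, walk b i j >].
have connP i j : reflect (exists b, walk b i j) (conn i j) by apply: asboolP.
have connC i j k : conn i j -> conn i k = conn j k.
  case/connP=> b ij; apply/connP/connP=> -[c].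
    by move=> ik; exists (b (+) c); apply: walk_trans (walk_sym ij) ik.
  by move=> jk; exists (b (+) c); apply: walk_trans ij jk.
(* [choose] gives the same vertex for equivalent predicates, so connected vertices share their
   root. *)
pose root i := choose (conn i) i.
have rootP i : conn i (root i).
  by apply: chooseP; apply/connP; exists false; apply: walk_refl.
have conn_refl i : conn i i by apply/connP; exists false; apply: walk_refl.
have rootE i j : conn i j -> root i = root j.
  move=> cij; rewrite /root (eq_choose (fun k => connC _ _ k cij)).
  by apply: choose_id; rewrite // -(connC i).
have edge_conn i j : edge X i j -> conn i j.
  by move=> ij; apply/connP; exists true; apply: edge_walk.
pose c0 i := `[< walk false (root i) i >].
have c0P i : walk (~~ c0 i) (root i) i.
  rewrite /c0; case: asboolP => // nw.
  by case/connP: (rootP i) => -[] /walk_sym.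
have c0_edge i j : edge X i j -> c0 i = ~~ c0 j.
  move=> ij; have wi := c0P i; have wj := c0P j.
  have := walk_trans wi (edge_walk ij); rewrite (rootE _ _ (edge_conn _ _ ij)).
  by case: (c0 i) (c0 j) wj => -[] // wj wj'; case: (no_odd _ _ _ wj wj').
exists (fun i => if conn y i then ~~ (c0 i (+) c0 y) else ~~ (c0 i (+) c0 x)).
split=> [i j ij||].
- have -> : conn y i = conn y j.
    have cC k l : conn k l = conn l k.
      by apply/connP/connP=> -[d /walk_sym]; exists d.
    by rewrite ![conn y _]cC; apply: connC; apply: edge_conn.
  by rewrite (c0_edge _ _ ij); case: ifP => _; case: (c0 j); case: (c0 _).
- case: (connP y x) => [[b /walk_sym wxy]|_]; last by rewrite addbb.
  have rxy : root x = root y by apply: rootE; apply/connP; exists b.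
  have wx := c0P x; have wy := c0P y; rewrite -rxy in wy.
  have := walk_trans (walk_sym wx) wy.
  by case: (c0 x) (c0 y) => -[].
by rewrite conn_refl addbb.
Qed.

End Walks.

(** * The inequalities of [R12] and the environment rule *)

Definition mon_le (m : mon) (N : nf) : Prop := nf_le (Some [fset m]) N.

Lemma mon_leE m N : mon_le m N <-> if N is Some X then m \in X else True.
Proof. by rewrite /mon_le /nf_le; case: N => // X; rewrite fsub1set. Qed.

(** A nonzero product has one factor among [Ra], [Rp] and the other among [Rb], [Rq]; so a valuation
    two-colours the graph of any term whose products it does not annihilate. *)
Definition is_ap (x : r12) : bool := if x is (Ra | Rp) then true else false.

Lemma r12_colour x y : r12_mul x y <> R0 ->
  r12_mul x y = Rc /\ is_ap x = ~~ is_ap y.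
Proof. by case: x; case: y. Qed.

Lemma walk_colour X (col : nat -> bool) b x y :
  (forall i j, edge X i j -> col i = ~~ col j) ->
  walk X b x y -> col x = b (+) col y.
Proof.
move=> colE [w [pw <- <-]]; elim: w x pw => //= z w IH x /andP[xz pw].
by rewrite (colE _ _ xz) (IH _ pw) addNb.
Qed.

Lemma r12_mul3 (x y z : r12) : r12_mul x (r12_mul y z) = R0.
Proof. by case: x; case: y; case: z. Qed.

Lemma size3_r12 (e : nat -> R12) (m : mon) : 3 <= size m ->
  evalm e m = Some R0 :> option R12.
Proof.
move=> m3; have [|i [n [Em En]]] := @mset_size_cons m;
  first exact: leq_trans m3.
have [|j [k [Ek Ekn]]] := @mset_size_cons n; first by lia.
have [|l [h [El _]]] := @mset_size_cons k; first by lia.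
rewrite Em Ek El
 !evalmD !evalm1; case: (evalm e h) => [a|] /=.
  by rewrite r12_mul3.
by rewrite r12_mul3.
Qed.

(** Below [R0] nothing is to be shown. If the value of [t] is not [R0], all its products are [Rc]:
    squares and higher monomials cannot occur, and [is_ap] two-colours the graph, which excludes odd
    cycles. *)
Lemma r12_sound t (m : mon) (e : nat -> R12) : 0 < size m ->
  mon_le m (env (mons t)) -> ole (evalm e m) (eval e t).
Proof.
move=> m_gt0; have [a Ea] := evalm_Some e m_gt0.
have [->|T0] := pselect (eval e t = R0 :> r12).
  by rewrite Ea => _; rewrite /ole /sle; case: a {Ea}.
have le_t n : n \in mons t -> ole (evalm e n) (eval e t) by exact: evalm_le.
have mul_c i j : [mset i; j]%mset \in mons t -> r12_mul (e i) (e j) <> R0.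
  move=> /le_t; rewrite evalm2 /= => + E0; rewrite /sle /= E0.
  by move: T0; case: (eval e t).
have colE i j : edge (mons t) i j -> is_ap (e i) = ~~ is_ap (e j).
  by case/andP=> _ /mul_c/r12_colour[].
rewrite mon_leE /env; case: asboolP => [|_].
  case=> [[i /mul_c]|[n /le_t + n3]|[[|i c] [/andP[/= cc _]] // oc]].
  - by case: (e i).
  - by rewrite (size3_r12 e n3) /= /sle /=; case: (eval e t) T0.
  have w : walk (mons t) true i i.
    by exists (rcons c i); rewrite cc last_rcons size_rcons.
  by have := walk_colour colE w; case: is_ap.
rewrite in_fsetU => /orP[/le_t //|].
case/imfset2P=> i _ [j]; rewrite inE => /andP[_ /asboolP[]].
(* An edge at a mark forces the value of [t] to be [Rc], so no mark has value [Rp]; two marks of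
   different colours then have product [Rc]. *)
move=> [/le_t + [i' ii']] [/le_t + [j' jj']] oij Em;
  have := walk_colour colE oij.
have [_ /mul_c/r12_colour[ci _]] := andP ii'.
have [_ /mul_c/r12_colour[cj _]] := andP jj'.
have [_ ii'_t] := andP ii'; have := le_t _ ii'_t.
rewrite Em !evalm1 !evalm2 /= ci /sle /=.
by move: ci cj T0; case: (eval e t) => //=; case: (e i) => //;
  case: (e j) => //.
Qed.

(** By contradiction: for each kind of missing monomial there is a valuation keeping [t] below [Rc]
    and sending [m] to a value not below [Rc]. *)
Lemma r12_complete t (m : mon) : 0 < size m ->
  (forall e : nat -> R12, ole (evalm e m) (eval e t)) ->
  mon_le m (env (mons t)).
Proof.
move=> m_gt0 le_t; rewrite mon_leE /env; case: asboolP => // nz.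
have noc : ~ odd_cycle (mons t) by move=> oc; apply: nz; apply: Or33.
have now i : ~ walk (mons t) true i i by move/odd_walk_cycle.
(* Since [t] is not basic-zero, its monomials are variables and edges only, so these two conditions
   bound its value by [Rc]. *)
have good e : (forall i, [mset i]%mset \in mons t -> r12_le (e i) Rc) ->
    (forall i j, edge (mons t) i j -> r12_mul (e i) (e j) = Rc) ->
    ole (evalm (e : nat -> R12) m) Rc.
  move=> lin quad; apply: ole_trans (le_t e) _.
  suff main (n : mon) : n \in mons t -> ole (evalm (e : nat -> R12) n) Rc.
    exact/eval_leP.
  move=> nt; have n_gt0 := mons_size nt.
  have [n3|] := leqP 3 (size n); first by case: nz; apply: Or32; exists n.
  rewrite ltnS leq_eqVlt => /orP[/eqP/mset_size2[i [j En]]|n1].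
    rewrite En evalm2 /= quad // /edge -En nt andbT.
    by apply/eqP => ij; apply: nz; apply: Or31; exists i; rewrite {2}ij -En.
  have [|i En] := @mset_size1 n; first by apply/eqP;
    rewrite eqn_leq n_gt0 -ltnS n1.
  by rewrite En evalm1 /=; apply/r12_leE/lin; rewrite -En.
pose ab (b : bool) := if b then Ra else Rb.
have ab_le b : r12_le (ab b) Rc by apply/r12_leE; case: b.
have ab_mul b : r12_mul (ab (~~ b)) (ab b) = Rc by case: b.
rewrite in_fsetU; apply: contrapT => /negP; rewrite negb_or => /andP[mt mD].
have two col : (forall i j, edge (mons t) i j -> col i = ~~ col j) ->
    ole (evalm (ab \o col : nat -> R12) m) Rc.
  move=> colE; apply: good => [i _|i j ij] /=; first exact: ab_le.
  by rewrite (colE i j ij) ab_mul.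
have [m3|] := leqP 3 (size m).
  have [col [colE _ _]] := @ex_coloring _ 0 0 noc (now 0).
  by have := two _ colE; rewrite size3_r12.
rewrite ltnS leq_eqVlt => /orP[/eqP/mset_size2[i [j Em]]|m1]; last first.
  have [|i Em] := @mset_size1 m; first by apply/eqP;
    rewrite eqn_leq m_gt0 -ltnS m1.
  have [col [colE coli _]] := @ex_coloring _ i i noc (now i).
  (* The variable [i] is not a summand, so it may take [Rp], which is not below [Rc]; its neighbours
     have value [Rb], and [Rp] times [Rb] is [Rc]. *)
  pose e z := if z == i then Rp else ab (col z).
  suff: ole (evalm (e : nat -> R12) m) Rc by rewrite Em evalm1 /= /e eqxx.
  apply: good => [z|k l kl]; rewrite /e.
    by case: eqP => [->|_ _ //]; rewrite -Em (negPf mt).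
  have := colE _ _ kl; case: eqP => [Ek|_]; case: eqP => [El|_].
  - by rewrite Ek El coli.
  - by rewrite Ek coli => /esym/negbTE->.
  - by rewrite El coli => ->.
  - by move=> ->.
(* The unmarked end [u] takes [Rp] and [v], which is not adjacent to it, takes [Rq]. The product is
   [R0], while [Rq] lies below [Rc] and is therefore harmless even if [v] is a summand. *)
have mixed u v : m = [mset u; v]%mset -> walk (mons t) true u v ->
    ~ marked (mons t) u -> False.
  move=> Euv wuv nu.
  have [col [colE colu _]] := @ex_coloring _ u u noc (now u).
  have colv : col v = false by have := walk_colour colE wuv; rewrite colu;
    case: (col v).
  pose e z := if z == u then Rp else if z == v then Rq else ab (col z).
  have uv : (v == u) = false by apply/eqP => E; rewrite E colu in colv.
  have nuv : edge (mons t) u v = false by rewrite /edge -Euv (negPf mt) andbF.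
  suff: ole (evalm (e : nat -> R12) m) Rc.
    by rewrite Euv evalm2 /= /e eqxx uv eqxx.
  apply: good => [z|k l kl]; rewrite /e.
    have [-> tu|_ _] := eqVneq z u.
      by case: nu; split=> //; apply: walk_edge wuv.
    by case: eqP => // _; apply/r12_leE.
  have := colE _ _ kl; have [Ek|_] := eqVneq k u.
    have [El|_] := eqVneq l u; first by rewrite Ek El colu.
    have [El|_] := eqVneq l v; first by rewrite Ek El nuv in kl.
    by rewrite Ek colu => /esym/negbTE->.
  have [El|_] := eqVneq l u.
    have [Ek|_] := eqVneq k v; first by rewrite Ek El edgeC nuv in kl.
    by rewrite El colu => ->.
  have [Ek|_] := eqVneq k v.
    have [El|_] := eqVneq l v; first by rewrite Ek El colv.
    by rewrite Ek colv; case: (col l).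
  have [El|_] := eqVneq l v; first by rewrite El colv => ->.
  by move=> ->.
(* Ends not joined by an odd walk can both take [Ra], whose square is [R0]. *)
have [wij|nij] := pselect (walk (mons t) true i j); last first.
  have [col [colE coli colj]] := @ex_coloring _ i j noc nij.
  by have := two _ colE; rewrite Em evalm2 /= coli colj.
have [mi|] := pselect (marked (mons t) i); last exact: mixed Em wij.
have [mj|] := pselect (marked (mons t) j); last first.
  by apply: (mixed j i _ (walk_sym wij)); rewrite Em mset2C.
move/negP: mD; apply; apply/imfset2P.
have in_vars k : marked (mons t) k -> k \in vars (mons t).
  case=> kS _; apply/imfset2P; exists [mset k]%mset => //; exists k => //=.
  by rewrite mem_finsupp msetnxx.
exists i; first exact: in_vars.
by exists j => //; rewrite inE in_vars //=; apply/asboolP.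
Qed.

(** * Substitutions and absorptions *)

Fixpoint tvars (t : term) : seq nat :=
  match t with
  | Var i => [:: i]
  | Add s t | Mul s t => tvars s ++ tvars t
  end.

Fixpoint factor_vars (t : term) : seq nat :=
  match t with
  | Var _ => [::]
  | Add s t => factor_vars s ++ factor_vars t
  | Mul s t => tvars s ++ tvars t
  end.

Fixpoint subst (s : nat -> term) (t : term) : term :=
  match t with
  | Var i => s i
  | Add t1 t2 => Add (subst s t1) (subst s t2)
  | Mul t1 t2 => Mul (subst s t1) (subst s t2)
  end.

Lemma rename_subst s t : rename s t = subst (Var \o s) t.
Proof. by elim: t => //= t1 -> t2 ->. Qed.

Lemma mons_renameVV s i j :
  mons (rename s (Mul (Var i) (Var j))) = [fset [mset s i; s j]%mset].
Proof. exact: mons_mulVV. Qed.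

Lemma tvars_rename s t : tvars (rename s t) = map s (tvars t).
Proof. by elim: t => //= t1 -> t2 ->; rewrite map_cat. Qed.

Lemma varsP (X : {fset mon}) i :
  i \in vars X <-> exists2 m : mon, m \in X & i \in m.
Proof.
split=> [/imfset2P[m /= mX [j /= jm ->]]|[m mX im]].
  by exists m; rewrite // -msuppE.
by apply/imfset2P; exists m => //; exists i => //=; rewrite msuppE.
Qed.

Lemma vars_mons t i : (i \in vars (mons t)) = (i \in tvars t).
Proof.
apply/idP/idP => [/varsP[m]|].
  elim: t m => [j|s IHs t IHt|s IHs t IHt] m /=.
  - by rewrite mons_var inE => /eqP->; rewrite in_mset1.
  - rewrite mons_add mem_cat => /orP[h|h] im; first by rewrite (IHs m).
    by rewrite (IHt m) ?orbT.
  case/mons_mulP=> n1 [n2 [n1s n2t ->]]; rewrite in_msetD mem_cat => /orP[h|h].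
    by rewrite (IHs n1).
  by rewrite (IHt n2) ?orbT.
move=> it; apply/varsP; elim: t it => [j|s IHs t IHt|s IHs t IHt] /=.
- by rewrite inE => /eqP->; exists [mset j]%mset; rewrite ?mons_var ?in_mset1.
- rewrite mem_cat => /orP[/IHs|/IHt] [m mt im]; exists m => //.
    by rewrite mons_add mt.
  by rewrite mons_add mt orbT.
have [[m ms] [n nt]] := (mons_neq0 s, mons_neq0 t).
rewrite mem_cat => /orP[/IHs|/IHt] [k kt ik].
  by exists (k `+` n)%mset; [apply: mem_mul | rewrite in_msetD ik].
by exists (m `+` k)%mset; [apply: mem_mul | rewrite in_msetD ik orbT].
Qed.

Lemma mons_subst_mono (s s' : nat -> term) t :
  (forall i, i \in tvars t -> mons (s i) `<=` mons (s' i)) ->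
  mons (subst s t) `<=` mons (subst s' t).
Proof.
elim: t => [i|t1 IH1 t2 IH2|t1 IH1 t2 IH2] h.
- by apply: h; rewrite inE.
- by apply: fsetUSS; [apply: IH1|apply: IH2] => i it; apply: h;
    rewrite mem_cat it ?orbT.
have /fsubsetP h1 : mons (subst s t1) `<=` mons (subst s' t1).
  by apply: IH1 => i it; apply: h; rewrite mem_cat it.
have /fsubsetP h2 : mons (subst s t2) `<=` mons (subst s' t2).
  by apply: IH2 => i it; apply: h; rewrite mem_cat it orbT.
apply/fsubsetP => m /mons_mulP[n1 [n2 [/h1 ? /h2 ? ->]]].
exact: mem_mul.
Qed.

Lemma tvars_subst_size s t i (n : mon) : i \in tvars t -> n \in mons (s i) ->
  exists2 m : mon, m \in mons (subst s t) & size n <= size m.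
Proof.
move=> + ni; elim: t => [j|t1 IH1 t2 IH2|t1 IH1 t2 IH2].
- by rewrite inE => /eqP <-; exists n.
- rewrite mem_cat => /orP[/IH1|/IH2] [m mt le_nm]; exists m => //.
    by rewrite mons_add mt.
  by rewrite mons_add mt orbT.
have [[m1 h1] [m2 h2]] := (mons_neq0 (subst s t1), mons_neq0 (subst s t2)).
rewrite mem_cat => /orP[/IH1|/IH2] [k kt le_nk].
  exists (k `+` m2)%mset; first exact: mem_mul.
  by rewrite size_msetD (leq_trans le_nk) // leq_addr.
exists (m1 `+` k)%mset; first exact: mem_mul.
by rewrite size_msetD (leq_trans le_nk) // leq_addl.
Qed.

Lemma factor_vars_subst_size s t i (n : mon) : i \in factor_vars t ->
  n \in mons (s i) -> exists2 m : mon, m \in mons (subst s t) & size n < size m.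
Proof.
move=> + ni; elim: t => [j|t1 IH1 t2 IH2|t1 _ t2 _] //.
  rewrite mem_cat => /orP[/IH1|/IH2] [m mt lt_nm]; exists m => //.
    by rewrite mons_add mt.
  by rewrite mons_add mt orbT.
have [[m1 h1] [m2 h2]] := (mons_neq0 (subst s t1), mons_neq0 (subst s t2)).
have [m1_gt0 m2_gt0] := (mons_size h1, mons_size h2).
rewrite mem_cat => /orP[it|it].
  have [k kt le_nk] := tvars_subst_size it ni.
  exists (k `+` m2)%mset; first exact: mem_mul.
  by rewrite size_msetD; lia.
have [k kt le_nk] := tvars_subst_size it ni.
exists (m1 `+` k)%mset; first exact: mem_mul.
by rewrite size_msetD; lia.
Qed.

Lemma factor_vars_sub t : {subset factor_vars t <= tvars t}.
Proof.
elim: t => [j|t1 IH1 t2 IH2|t1 _ t2 _] i //.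
by rewrite !mem_cat => /orP[/IH1|/IH2] ->; rewrite ?orbT.
Qed.

(* Every variable of the right-hand side occurs in a product, so that a
   substitution sending some variable to a nonlinear term makes it zero. *)
Definition absorption (q v : term) : Prop :=
  ((exists i, q = Var i) \/ exists i j, q = Mul (Var i) (Var j)) /\
  {subset tvars q ++ tvars v <= factor_vars v}.

Lemma absorption_vars (q v : term) s : absorption q v ->
  vars (mons (rename s q)) `<=` vars (mons (rename s v)).
Proof.
case=> _ sub; apply/fsubsetP => i; rewrite !vars_mons !tvars_rename.
case/mapP=> j jq ->; apply: map_f; apply: factor_vars_sub; apply: sub.
by rewrite mem_cat jq.
Qed.

(** A monomial of degree at least three would make [X] basic-zero, so [s] sends the variables
    concerned to sums of variables. A monomial of the substituted query selects a variable from each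
    sum, and a renaming extending this selection falls under the hypothesis. *)
Lemma absorption_subst (X : {fset mon}) (q v : term) (s : nat -> term) :
  absorption q v -> ~ basic_zero X ->
  (forall r, mons (rename r v) `<=` X -> mons (rename r q) `<=` X) ->
  mons (subst s v) `<=` X -> mons (subst s q) `<=` X.
Proof.
case=> shape sub nz rX vX.
have lin i (n : mon) : i \in tvars q ++ tvars v -> n \in mons (s i) ->
    exists j, n = [mset j]%mset.
  move=> /sub iv ni; have [m mv lt_nm] := factor_vars_subst_size iv ni.
  apply: mset_size1; apply/eqP; rewrite eqn_leq (mons_size ni) andbT -ltnS.
  apply: contrapT => /negP; rewrite -leqNgt => n2; apply: nz; apply: Or32.
  by exists m; [apply: (fsubsetP vX) | apply: leq_trans lt_nm].
have qv i : i \in tvars q -> i \in tvars v.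
  by move=> iq; apply: factor_vars_sub; apply: sub; rewrite mem_cat iq.
have inX r : (forall i, i \in tvars v -> [mset r i]%mset \in mons (s i)) ->
    mons (rename r q) `<=` X.
  move=> rs; apply: rX; rewrite rename_subst; apply: fsubset_trans vX.
  by apply: mons_subst_mono => i /rs; rewrite fsub1set.
have ex_r i : exists j, i \in tvars v -> [mset j]%mset \in mons (s i).
  have [iv|] := boolP (i \in tvars v); last by exists 0.
  have [n ni] := mons_neq0 (s i); have [|j nj] := lin i n _ ni.
    by rewrite mem_cat iv orbT.
  by exists j => _; rewrite -nj.
have [r rs] := choice ex_r.
apply/fsubsetP => m; case: shape => [[i Eq]|[i [j Eq]]]; subst q.
  move=> mi; have [|k Ek] := lin i m _ mi; first by rewrite inE eqxx.
  have := inX (fun z => if z == i then k else r z); rewrite /= eqxx fsub1set.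
  rewrite Ek; apply => z zv; case: eqP => [->|_]; last exact: rs.
  by rewrite -Ek.
case/mons_mulP=> n1 [n2 [n1i n2j ->]].
have [|k1 Ek1] := lin i n1 _ n1i; first by rewrite inE eqxx.
have [|k2 Ek2] := lin j n2 _ n2j; first by rewrite !inE eqxx orbT.
have [ij|nij] := eqVneq i j.
  (* For a square query the two factors may select different variables, which no renaming imitates;
     but any renaming already puts a square into [X]. *)
  case: nz; apply: Or31; exists (r i).
  have := inX r rs; rewrite -ij.
  by rewrite mons_renameVV fsub1set.
have := inX (fun z => if z == i then k1 else if z == j then k2 else r z).
rewrite mons_renameVV fsub1set eqxx eq_sym (negPf nij) eqxx Ek1 Ek2;
  apply => z zv.
case: eqP => [->|_]; first by rewrite -Ek1.
by case: eqP => [->|_]; [rewrite -Ek2 | exact: rs].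
Qed.

Lemma absorption_F25 f : f <> f_tau -> absorption (absorbed f) (absorber f).
Proof.
move=> nt; split; last by apply/allP; case: f nt.
by case: f nt => // _; try (by left; eexists); right; do 2!eexists.
Qed.

Lemma identityE f : f <> f_tau ->
  identity f = below (absorbed f) (absorber f) \/
  exists x, absorbed f = Mul (Var x) (Var x) /\
            identity f = (absorbed f, absorber f).
Proof. by case: f => // _; (try by left); right; exists 6. Qed.

(** * The path identities as absorptions *)

Definition gamma_query (n : nat) : term := Mul (Var 0) (Var (2 * n).+1).

Definition gammaD_rhs (n : nat) : term :=
  Add (gamma_rhs n) (tD (Var (2 * n).+2) (Var (2 * n).+3)).

Lemma mons_foldl_sub s (X : {fset mon}) t ts :
  (mons (rename s (foldl Add t ts)) `<=` X) =
  (mons (rename s t) `<=` X) && all (fun u => mons (rename s u) `<=` X) ts.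
Proof.
by elim: ts t => [|u ts IH] t /=; rewrite ?andbT // IH /= fsubUset andbA.
Qed.

Lemma tvars_foldl i t ts :
  (i \in tvars (foldl Add t ts)) =
  (i \in tvars t) || has (fun u => i \in tvars u) ts.
Proof.
by elim: ts t => [|u ts IH] t /=; rewrite ?orbF // IH /= mem_cat orbA.
Qed.

Lemma factor_vars_foldl i t ts :
  (i \in factor_vars (foldl Add t ts)) =
  (i \in factor_vars t) || has (fun u => i \in factor_vars u) ts.
Proof.
by elim: ts t => [|u ts IH] t /=; rewrite ?orbF // IH /= mem_cat orbA.
Qed.

Lemma gamma_rhs_sub n s (X : {fset mon}) :
  mons (rename s (gamma_rhs n)) `<=` X <->
  [/\ [mset s 0]%mset \in X, [mset s (2 * n)]%mset \in X,
      forall j, j < 2 * n -> [mset s j; s j.+1]%mset \in X &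
      [mset s (2 * n); s (2 * n).+1]%mset \in X].
Proof.
pose P u := mons (rename s u) `<=` X.
have PV i : P (Var i) = ([mset s i]%mset \in X) by exact: fsub1set.
have PM i j : P (Mul (Var i) (Var j)) = ([mset s i; s j]%mset \in X).
  by rewrite /P mons_renameVV fsub1set.
rewrite /gamma_rhs mons_foldl_sub -[all _ _]/(all P _) -[_ `<=` X]/(P _).
rewrite -cat1s !all_cat !all_seq1 all_map !PV PM; split.
  case/and4P=> -> -> /allP h ->; split=> // j jn; rewrite -PM; apply: h.
  by rewrite mem_iota.
case=> -> -> h ->; rewrite andbT; apply/allP => j; rewrite mem_iota => /h.
by rewrite -PM.
Qed.

Lemma tD_sub i j s (X : {fset mon}) :
  mons (rename s (tD (Var i) (Var j))) `<=` X <->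
  [/\ [mset s i]%mset \in X, [mset s j]%mset \in X &
      [mset s i; s j]%mset \in X].
Proof.
rewrite -!fsub1set -mons_renameVV.
split; first by rewrite !fsubUset => /andP[/andP[]].
by case=> hi hj hij; rewrite !fsubUset hij andbT; apply/andP.
Qed.

Lemma gamma_rhs_tvars n i :
  i \in [:: 0; (2 * n).+1] ++ tvars (gamma_rhs n) -> i <= (2 * n).+1.
Proof.
rewrite /= !in_cons /gamma_rhs tvars_foldl /= has_cat has_map /= !inE orbF.
case/or4P => [/eqP->|/eqP->|/eqP->|] //.
case/or3P => [/eqP->|/hasP[j]|/orP[] /eqP-> //]; first exact: leqW.
rewrite mem_iota !inE => jn /orP[] /eqP->; first by lia.
by lia.
Qed.

Lemma gamma_rhs_factor_vars n i :
  i <= (2 * n).+1 -> i \in factor_vars (gamma_rhs n).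
Proof.
move=> i_le; rewrite /gamma_rhs factor_vars_foldl /= has_cat has_map /=.
have [i_n|n_i] := ltnP i (2 * n).
  by apply/orP; left; apply/hasP; exists i; rewrite ?mem_iota //= inE eqxx.
rewrite !inE; apply/orP; right; rewrite orbF.
by apply/orP; case: (eqVneq i (2 * n)); [left | right; lia].
Qed.

Lemma absorption_gamma n : absorption (gamma_query n) (gamma_rhs n).
Proof.
split; first by right; do 2!eexists.
by move=> i /gamma_rhs_tvars /gamma_rhs_factor_vars.
Qed.

Lemma absorption_gammaD n : absorption (gamma_query n) (gammaD_rhs n).
Proof.
split; first by right; do 2!eexists.
move=> i h.
have h2 : i \in ([:: 0; (2 * n).+1] ++ tvars (gamma_rhs n)) ++
    [:: (2 * n).+2; (2 * n).+3; (2 * n).+2; (2 * n).+3] by exact: h.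
rewrite [factor_vars _]/= mem_cat; move: h2.
rewrite mem_cat {h} => /orP[/gamma_rhs_tvars h|].
  by rewrite gamma_rhs_factor_vars.
by rewrite !inE => /or4P[] ->; rewrite ?orbT.
Qed.

(** * Closed sets and the algebra of normal forms *)

Section ClosedSets.
Variables (H : pred F25) (p q : threshold).
Local Notation closed_nf := (closed_nf H p q).

Lemma closed_not_zero (X : {fset mon}) : closed_nf (Some X) -> ~ basic_zero X.
Proof. by case=> _ _ /closed_envP[]. Qed.

Lemma closed_edge (X : {fset mon}) i j :
  closed_nf (Some X) -> [mset i; j]%mset \in X -> edge X i j.
Proof.
move=> /closed_not_zero nz ij; apply/andP; split=> //.
by apply/eqP => E; apply: nz; apply: Or31; exists i; rewrite {2}E.
Qed.

(** The path of [gamma_rhs n] is mapped to a walk of length [2 * n], possibly with repeated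
    vertices. Its even length gives the class, and its length bounds the distance. *)
Lemma closed_gamma_walk (X : {fset mon}) n s (k : threshold) :
  closed_nf (Some X) -> 1 <= n -> nat_le_thr n k ->
  mons (rename s (gamma_rhs n)) `<=` X ->
  [/\ marked X (s 0), marked X (s (2 * n)), same_class X (s 0) (s (2 * n)),
      dist_le_double X k (s 0) (s (2 * n)) & edge X (s (2 * n)) (s (2 * n).+1)].
Proof.
move=> cX n_gt0 nk /gamma_rhs_sub[m0 mn path_s last_s].
have edge_s j : j < 2 * n -> edge X (s j) (s j.+1).
  by move=> /path_s; apply: closed_edge.
have last_e := closed_edge cX last_s.
have walk_s j : j <= 2 * n ->
    path (edge X) (s 0) [seq s i | i <- iota 1 j] /\
    last (s 0) [seq s i | i <- iota 1 j] = s j.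
  elim: j => // j IH jn; have [pj lj] := IH (ltnW jn).
  have -> : iota 1 j.+1 = iota 1 j ++ [:: j.+1]
    by rewrite -[j.+1]addn1 iotaD addn1.
  by rewrite map_cat cat_path last_cat pj lj /= edge_s.
have [pw lw] := walk_s _ (leqnn _).
split=> //.
- by split=> //; exists (s 1); apply: edge_s; lia.
- by split=> //; exists (s (2 * n).+1).
- exists [seq s i | i <- iota 1 (2 * n)]; split=> //.
  by rewrite size_map size_iota mul2n odd_double.
exists [seq s i | i <- iota 1 (2 * n)]; split=> //.
by case: k nk => //= k; rewrite size_map size_iota leq_mul2l.
Qed.

(** The active threshold is [p] or [q], and [n] is within both because [p] is at most [q]. *)
Lemma closed_gamma (X : {fset mon}) n s : thr_le p q ->
  closed_nf (Some X) -> 1 <= n -> nat_le_thr n p ->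
  mons (rename s (gamma_rhs n)) `<=` X ->
  mons (rename s (gamma_query n)) `<=` X.
Proof.
move=> pq cX n_gt0 np; set k := if `[< has_D_component X >] then q else p.
have nk : nat_le_thr n k.
  rewrite /k; case: ifP => // _; case: (p) (q) pq np => [i|] [j|] //= ij ni.
  exact: leq_trans ij.
case/(closed_gamma_walk cX n_gt0 nk) => m0 mn same0n d0n en.
rewrite mons_renameVV fsub1set; case: cX => _ dX _.
exact: dX m0 mn same0n d0n en.
Qed.

(** The image of the D-summand is an edge with both ends marked, hence a D-component, so the active
    threshold is [q]. *)
Lemma closed_gammaD (X : {fset mon}) n s :
  closed_nf (Some X) -> 1 <= n -> nat_le_thr n q ->
  mons (rename s (gammaD_rhs n)) `<=` X ->
  mons (rename s (gamma_query n)) `<=` X.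
Proof.
move=> cX n_gt0 nq; rewrite fsubUset => /andP[gX /tD_sub[mi mj ij]].
have eij := closed_edge cX ij.
have [m0 mn same0n d0n en] := closed_gamma_walk cX n_gt0 nq gX.
rewrite mons_renameVV fsub1set; case: cX => _ dX _.
move: dX; rewrite /closed_dist; case: asboolP => [_ dX|[]].
  exact: dX m0 mn same0n d0n en.
exists (s (2 * n).+2), (s (2 * n).+3); split.
- by split=> //; exists (s (2 * n).+3).
- by split=> //; exists (s (2 * n).+2); rewrite edgeC.
exact: edge_walk.
Qed.

Lemma closed_env_le (X Y : {fset mon}) :
  closed_env X -> Y `<=` X -> nf_le (env Y) (Some X).
Proof.
move=> /closed_envP[nz eX] YX; rewrite /env; case: asboolP => [zY|_].
  by apply: nz; apply: basic_zero_mono zY.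
apply/fsubsetP => m; rewrite in_fsetU => /orP[/(fsubsetP YX)//|].
case/imfset2P=> i _ [j]; rewrite inE => /andP[_ /asboolP[mi mj oij]] ->.
by apply: eX; [apply: marked_mono mi | apply: marked_mono mj
  | apply: opp_class_mono oij].
Qed.

(** The monomials of [X] supported on [V]. Extensions of [v] may use only its variables, so a larger
    closed set is cut down before being compared with the normal form. *)
Definition restrict (X : {fset mon}) (V : {fset nat}) : {fset mon} :=
  [fset m : mon in X | [forall i : finsupp m, val i \in V]].

Lemma restrictP X V (m : mon) :
  m \in restrict X V <-> m \in X /\ forall i, i \in m -> i \in V.
Proof.
rewrite in_fset /= inE; split=> [/andP[mX /forallP h]|[mX h]].
  split=> // i; rewrite -msuppE => im; exact: (h [` im]).
by rewrite mX; apply/forallP => i; apply: h; rewrite -msuppE; apply: valP.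
Qed.

Lemma restrict_sub X V : restrict X V `<=` X.
Proof. by apply/fsubsetP => m /restrictP[]. Qed.

Lemma restrict_mons X V t :
  mons t `<=` X -> (forall i, i \in tvars t -> i \in V) ->
  mons t `<=` restrict X V.
Proof.
move=> /fsubsetP tX tV; apply/fsubsetP => m mt; apply/restrictP.
split=> [|i im]; first exact: tX.
by apply: tV; rewrite -vars_mons; apply/varsP; exists m.
Qed.

Lemma edge_restrict X V i j : edge (restrict X V) i j -> i \in V /\ j \in V.
Proof.
case/andP=> _ /restrictP[_ h].
by split; apply: h; rewrite in_mset2 eqxx ?orbT.
Qed.

Lemma restrict_edge X V i j : [mset i; j]%mset \in X -> i \in V -> j \in V ->
  [mset i; j]%mset \in restrict X V.
Proof.
move=> ij iV jV; apply/restrictP; split=> // k.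
by rewrite in_mset2 => /orP[] /eqP->.
Qed.

Lemma restrict_marked X V i : marked (restrict X V) i -> i \in V.
Proof. by case=> _ [j /edge_restrict[]]. Qed.

Hypothesis pq : thr_le p q.
Hypothesis no_tau : ~~ H f_tau.

Lemma not_tau f : H f -> f <> f_tau.
Proof. by move=> Hf Ef; move: no_tau; rewrite -Ef Hf. Qed.

(** Every rule inserts monomials in the variables of its premises. Restriction can only destroy
    D-components, so the threshold can only drop from [q] to [p], and the distance rule of [X] still
    covers it. *)
Lemma restrict_closed X V : closed_nf (Some X) ->
  closed_nf (Some (restrict X V)).
Proof.
case=> rX dX /closed_envP[nz eX]; have sub := @restrict_sub X V; split.
- move=> f s Hf vX; apply: restrict_mons.
    by apply: rX Hf _; apply: fsubset_trans vX _.
  move=> i iq; have [m mv im] : exists2 m : mon,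
    m \in mons (rename s (absorber f)) & i \in m.
    apply/varsP.
    apply: (fsubsetP (absorption_vars s (absorption_F25 (not_tau Hf)))).
    by rewrite vars_mons.
  by have /restrictP[_] := fsubsetP vX _ mv; apply.
- move=> x x' y mx mx' sxx' dxx' ex'y.
  have [_ yV] := edge_restrict ex'y.
  apply: restrict_edge (restrict_marked mx) yV.
  apply: (dX x x' y); [exact: marked_mono mx | exact: marked_mono mx'
    | exact: same_class_mono sxx' | | exact: edge_mono ex'y].
  apply: dist_mono dxx' => //.
  case: asboolP => [[a [b [ma mb ab]]]|_];
    last by case: ifP; rewrite ?thr_le_refl.
  case: asboolP => [_|[]]; first exact: thr_le_refl.
  by exists a, b; split; [exact: marked_mono ma | exact: marked_mono mb
    | exact: opp_class_mono ab].
apply/closed_envP; split; first by move=> /(basic_zero_mono sub).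
move=> x y mx my oxy.
apply: restrict_edge (restrict_marked mx) (restrict_marked my).
by apply: eX; [exact: marked_mono mx | exact: marked_mono my
  | exact: opp_class_mono oxy].
Qed.

Local Notation nform := (nform H p q).

Lemma nform_mons s t : mons s = mons t -> nform s = nform t.
Proof. by rewrite /Defs.nform => ->. Qed.

Lemma nform_closed v : closed_nf (nform v).
Proof. by have [[]] := nformP v pq no_tau. Qed.

Lemma env_le_nform v : nf_le (env (mons v)) (nform v).
Proof. by have [[]] := nformP v pq no_tau. Qed.

Lemma mons_le_env v : nf_le (Some (mons v)) (env (mons v)).
Proof. by rewrite /env; case: asboolP => //= _; apply: fsubsetUl. Qed.

Lemma nf_le_trans M N P : nf_le M N -> nf_le N P -> nf_le M P.
Proof. by case: M N P => [X|] [Y|] [Z|] //=; apply: fsubset_trans. Qed.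

Lemma nf_le_refl N : nf_le N N.
Proof. by case: N => /=. Qed.

Lemma mons_le_nform v : nf_le (Some (mons v)) (nform v).
Proof. exact: nf_le_trans (mons_le_env v) (env_le_nform v). Qed.

(** The universal property of a closure operator. Leastness speaks only of extensions in the
    variables of [v], so [N] is first restricted to them. *)
Lemma nform_leP v N :
  closed_nf N -> nf_le (nform v) N <-> nf_le (Some (mons v)) N.
Proof.
move=> cN; split=> [|vN]; first exact: nf_le_trans (mons_le_nform v).
have [_ least] := nformP v pq no_tau.
case: N cN vN => [X|] cX vX; last by case: (nform v).
have cR := restrict_closed (vars (mons v)) cX.
apply: nf_le_trans (least (Some (restrict X (vars (mons v)))) _) _; last first.
  exact: restrict_sub.
split=> //.
  by apply/fsubsetP => i /varsP[m /restrictP[_ h] im]; apply: h.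
case: cR => _ _ cR; apply: closed_env_le => //.
by apply: restrict_mons => // i; rewrite vars_mons.
Qed.

Lemma nform_le u v : nf_le (nform u) (nform v) <->
  nf_le (Some (mons u)) (nform v).
Proof. exact/nform_leP/nform_closed. Qed.

Lemma nform_add_leP s t N : closed_nf N ->
  nf_le (nform (Add s t)) N <-> nf_le (nform s) N /\ nf_le (nform t) N.
Proof.
move=> cN; rewrite !nform_leP //; case: N {cN} => //= X.
by rewrite fsubUset; split=> [/andP[]|[-> ->]].
Qed.

Lemma nform_add_le s s' t t' :
  nf_le (nform s) (nform s') -> nf_le (nform t) (nform t') ->
  nf_le (nform (Add s t)) (nform (Add s' t')).
Proof.
move=> ss' tt'; apply/nform_add_leP; first exact: nform_closed.
have /nform_add_leP[|h1 h2] := nf_le_refl (nform (Add s' t')).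
  exact: nform_closed.
by split; [apply: nf_le_trans h1 | apply: nf_le_trans h2].
Qed.

Lemma nform_add s s' t t' : nform s = nform s' -> nform t = nform t' ->
  nform (Add s t) = nform (Add s' t').
Proof.
by move=> ss' tt'; apply: nf_le_anti; apply: nform_add_le;
  rewrite ?ss' ?tt'; apply: nf_le_refl.
Qed.

Lemma nform_below u v :
  nform (Add u v) = nform v <-> nf_le (Some (mons u)) (nform v).
Proof.
rewrite -nform_le; split=> [<-|uv].
  by have /nform_add_leP[|] := nf_le_refl (nform (Add u v));
    first exact: nform_closed.
apply: nf_le_anti; first by apply/nform_add_leP;
  [apply: nform_closed | split=> //; apply: nf_le_refl].
by have /nform_add_leP[|] := nf_le_refl (nform (Add u v));
  first exact: nform_closed.
Qed.

Definition linear_term t := forall m : mon, m \in mons t -> size m = 1.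

(** Each absorber contains a product, so no rule of [H] applies to a sum of variables; without edges
    there are no marks either. *)
Lemma linear_nform t : linear_term t -> nform t = Some (mons t).
Proof.
move=> lt; apply: nf_le_anti; last exact: mons_le_nform.
have no2 i j : [mset i; j]%mset \notin mons t.
  by apply/negP => /lt; rewrite size_mset2.
have noe i j : edge (mons t) i j = false
    by rewrite /edge (negPf (no2 i j)) andbF.
apply/nform_leP; last exact: fsubset_refl; split.
- move=> f s Hf /fsubsetP vt; have [_ sub] := absorption_F25 (not_tau Hf).
  have [i iq] : exists i, i \in tvars (absorbed f).
    by case: f {Hf vt sub}; eexists; apply: mem_head.
  have : i \in factor_vars (absorber f) by apply: sub; rewrite mem_cat iq.
  case/(@factor_vars_subst_size (Var \o s) _ _ [mset s i]%mset).
    by rewrite mons_var.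
  by move=> m; rewrite -rename_subst size_mset1 => /vt/lt->.
- by move=> x x' y [_ [z]]; rewrite noe.
apply/closed_envP; split; last by move=> x y [_ [z]]; rewrite noe.
case=> [[i]|[m /lt ->]|[[|i c] [/andP[cc _] oc]]] //.
  by rewrite (negPf (no2 i i)).
by move: cc; case: c {oc} => [|j c] /=; rewrite noe.
Qed.

Lemma basic_zero_nform t : basic_zero (mons t) -> nform t = None.
Proof.
move=> z; have := mons_le_nform t; have := nform_closed t.
case: (nform t) => // X /closed_not_zero nz /= tX.
by case: nz; apply: basic_zero_mono z.
Qed.

Lemma nonlinear_nform_mul s t : ~ linear_term s -> nform (Mul s t) = None.
Proof.
move=> nl; apply: basic_zero_nform; apply: Or32.
have [m ms m2] : exists2 m : mon, m \in mons s & 1 < size m.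
  apply: contrapT => no; apply: nl => m ms; apply/eqP; rewrite eqn_leq.
  rewrite (mons_size ms) andbT leqNgt; apply/negP => m2; apply: no.
  by exists m.
have [n nt] := mons_neq0 t; exists (m `+` n)%mset; first exact: mem_mul.
by rewrite size_msetD; have := mons_size nt; lia.
Qed.

(** A linear term is its own normal form. Hence either both factors are linear with the same
    monomials, or both are nonlinear and both products are zero. *)
Lemma nform_mul_l s s' t : nform s = nform s' ->
  nform (Mul s t) = nform (Mul s' t).
Proof.
move=> E.
have half u u' : nform u = nform u' -> linear_term u -> linear_term u'.
  move=> Eu lu m mu'; have := mons_le_nform u'; rewrite -Eu linear_nform //.
  by move/fsubsetP/(_ _ mu')/lu.
have [ls|ns] := pselect (linear_term s); last first.
  by rewrite !nonlinear_nform_mul // => /(half _ _ (esym E)).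
have ls' := half _ _ E ls.
move: E; rewrite (linear_nform ls) (linear_nform ls') => -[E].
by apply: nform_mons; rewrite /= E.
Qed.

(** Valid inequalities of [R12] are accounted for by the environment normal form, which every
    closure contains. *)
Lemma r12_nform s t :
  (forall e : nat -> R12, eval e s = eval e t) -> nform s = nform t.
Proof.
have half u v : (forall e : nat -> R12, eval e u = eval e v) ->
    nf_le (nform u) (nform v).
  move=> Euv; apply/nform_le; apply: nf_le_trans (env_le_nform v).
  suff h (m : mon) : m \in mons u -> mon_le m (env (mons v)).
    move: h; case: (env (mons v)) => // X h /=; apply/fsubsetP => m /h.
    by rewrite mon_leE.
  move=> mu; apply: r12_complete; first exact: mons_size mu.
  by move=> e; rewrite -Euv; apply: evalm_le.
by move=> E; apply: nf_le_anti; apply: half => // e; rewrite E.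
Qed.

Lemma absorption_nform q' v s : absorption q' v ->
  (forall X r, closed_nf (Some X) ->
    mons (rename r v) `<=` X -> mons (rename r q') `<=` X) ->
  nf_le (Some (mons (subst s q'))) (nform (subst s v)).
Proof.
move=> ab rX; have := nform_closed (subst s v);
  have := mons_le_nform (subst s v).
case: (nform _) => //= X vX cX.
by apply: absorption_subst ab (closed_not_zero cX) _ vX => r; apply: rX.
Qed.

Lemma mul_self_nform t : nform (Mul t t) = None.
Proof.
have [m mt] := mons_neq0 t; have [lt|nl] := pselect (linear_term t).
  apply: basic_zero_nform; apply: Or31.
  by have [i Em] := mset_size1 (lt _ mt); exists i; apply: mem_mul; rewrite -Em.
exact: nonlinear_nform_mul.
Qed.

Lemma identity_nform f s : H f ->
  nform (subst s (identity f).1) = nform (subst s (identity f).2).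
Proof.
move=> Hf; have nt := not_tau Hf.
have le_f :
  nf_le (Some (mons (subst s (absorbed f)))) (nform (subst s (absorber f))).
  apply: absorption_nform (absorption_F25 nt) _ => X r [rX _ _]; exact: rX.
have [->|[x [Ex ->]]] := identityE nt; first exact/nform_below.
(* A square has the greatest normal form, so for the square identities the inequality is already an
   equality. *)
move/nform_le: le_f; rewrite Ex /= mul_self_nform.
by case: (nform _).
Qed.

End ClosedSets.

(** * Soundness: the set of valid monomials is closed *)

Lemma eval_rename (A : aiSemiring) (e : nat -> A) s t :
  eval e (rename s t) = eval (e \o s) t.
Proof. by elim: t => //= t1 -> t2 ->. Qed.

Lemma absorption_size (q v : term) s (m : mon) : absorption q v ->
  m \in mons (rename s q) -> size m <= 2.
Proof.
case=> -[[i ->]|[i [j ->]]] _.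
  by rewrite mons_var => /eqP->; rewrite size_mset1.
by rewrite mons_renameVV in_fset1 => /eqP->; rewrite size_mset2.
Qed.

(** With [m] represented by a term, the inequality is an identity of [R12] and passes to the whole
    variety. *)
Lemma variety_env (A : aiSemiring) (e : nat -> A) t (m : mon) :
  variety R12 A -> 0 < size m -> mon_le m (env (mons t)) ->
  ole (evalm e m) (eval e t).
Proof.
move=> vA m_gt0 mt; have [w Ew] := ex_mon_term m_gt0.
apply/(eval_mon_leP _ _ Ew); apply: (variety_sat (i := below w t) vA) => e'.
exact/(eval_mon_leP _ _ Ew)/r12_sound.
Qed.

Section Soundness.
Variables (H : pred F25) (p q : threshold).

Definition valid_le (m : mon) (v : term) : Prop :=
  forall A, subvariety H p q A -> forall e : nat -> A,
    ole (evalm e m) (eval e v).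

(** A finite universe for the valid monomials: a nonzero closed extension of [v] contains only
    monomials of degree at most two in the variables of [v]. *)
Definition candidates (V : {fset nat}) : {fset mon} :=
  [fset [mset x]%mset | x in V] `|` [fset [mset x; y]%mset | x in V, y in V].

Lemma candidatesP V (m : mon) : 0 < size m <= 2 -> (forall i, i \in m ->
  i \in V) ->
  m \in candidates V.
Proof.
case/andP=> m_gt0; rewrite leq_eqVlt => /orP[/eqP/mset_size2[i [j ->]]|m1] mV;
  rewrite in_fsetU.
  apply/orP; right; apply/imfset2P; exists i; first by apply: mV;
    rewrite mset21.
  by exists j => //; apply: mV; rewrite mset22.
have [|i Em] := @mset_size1 m; first by apply/eqP;
  rewrite eqn_leq m_gt0 -ltnS m1.
apply/orP; left; rewrite Em; apply/imfsetP; exists i => //.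
by apply: mV; rewrite Em mset11.
Qed.

Lemma candidates_sub V (m : mon) : m \in candidates V ->
  0 < size m /\ forall i, i \in m -> i \in V.
Proof.
rewrite in_fsetU => /orP[/imfsetP[i iV ->]|/imfset2P[i iV [j jV ->]]].
  by rewrite size_mset1; split=> // k; rewrite in_mset1 => /eqP->.
by rewrite size_mset2; split=> // k; rewrite in_mset2 => /orP[] /eqP->.
Qed.

Definition valid_set (v : term) : {fset mon} :=
  [fset m : mon in candidates (vars (mons v)) | `[< valid_le m v >]].

Lemma valid_setP v (m : mon) : m \in valid_set v <->
  m \in candidates (vars (mons v)) /\ valid_le m v.
Proof.
by rewrite in_fset /= inE; split=> [/andP[? /asboolP]|[-> ?]] //; apply/asboolP.
Qed.

Definition valid_nf (v : term) : nf :=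
  if `[< forall m : mon, 0 < size m -> valid_le m v >] then None
  else Some (valid_set v).

Section NonZero.
Variable v : term.
Hypothesis nonzero : ~ forall m : mon, 0 < size m -> valid_le m v.
Local Notation X := (valid_set v).

Lemma mons_sub_valid : mons v `<=` X.
Proof.
apply/fsubsetP => m mv; apply/valid_setP; split; last first.
  by move=> A _ e; apply: evalm_le.
apply: candidatesP => [|i im]; last by apply/varsP; exists m.
rewrite (mons_size mv) /= leqNgt; apply/negP => m3; apply: nonzero => n n_gt0.
move=> A [vA _ _ _] e; apply: variety_env => //.
rewrite mon_leE /env; case: asboolP => // nz.
by case: nz; apply: Or32; exists m.
Qed.

(** Read as a term, [X] has value below that of [v] in every member, so whatever the environment
    rule derives from [X] is again valid. *)
Lemma valid_set_closed (m : mon) :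
  0 < size m -> mon_le m (env X) -> valid_le m v.
Proof.
move=> m_gt0 mX A sA e; have [vA _ _ _] := sA.
have [||t Et] := @ex_term X.
- have [n nv] := mons_neq0 v; exists n; exact: (fsubsetP mons_sub_valid).
- by move=> n /valid_setP[/candidates_sub[]].
rewrite -Et in mX; apply: ole_trans (variety_env e vA m_gt0 mX) _.
by apply/eval_leP => n; rewrite Et => /valid_setP[_]; apply.
Qed.

Lemma valid_closed_env : closed_env X.
Proof.
apply/closed_envP; split=> [zX|x y mx my oxy].
  (* If [X] were basic-zero, its environment form would be zero and every monomial valid. *)
  apply: nonzero => m m_gt0; apply: valid_set_closed => //.
  by rewrite mon_leE /env; case: asboolP.
have in_vars k : marked X k -> k \in vars X.
  by case=> kX _; apply/varsP; exists [mset k]%mset; rewrite ?in_mset1.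
have subV : forall k, marked X k -> k \in vars (mons v).
  by move=> k [/valid_setP[/candidates_sub[_ h] _] _]; apply: h; rewrite mset11.
apply/valid_setP; split.
  apply: candidatesP; first by rewrite size_mset2.
  by move=> k; rewrite in_mset2 => /orP[] /eqP->; apply: subV.
apply: valid_set_closed; first by rewrite size_mset2.
rewrite mon_leE /env; case: asboolP => // _; rewrite in_fsetU; apply/orP; right.
apply/imfset2P; exists x; first exact: in_vars.
by exists y => //; rewrite inE in_vars //=; apply/asboolP.
Qed.

(** The summands of the renamed [v'] are valid, so its value, and with it that of the query, lies
    below the value of [v]. *)
Lemma valid_absorption (q' v' : term) s : absorption q' v' ->
  (forall A, subvariety H p q A -> sat A (below q' v')) ->
  mons (rename s v') `<=` X -> mons (rename s q') `<=` X.
Proof.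
move=> ab sat_qv vX; apply/fsubsetP => m mq; apply/valid_setP; split.
  apply: candidatesP => [|i im];
    first by rewrite (mons_size mq) (absorption_size ab mq).
  have /varsP[n /(fsubsetP vX)/valid_setP[/candidates_sub[_ h] _] /h//] :
    i \in vars (mons (rename s v')).
  by apply: (fsubsetP (absorption_vars s ab)); apply/varsP; exists m.
move=> A sA e; apply: ole_trans (evalm_le e mq) _.
apply: (@sle_trans _ (eval e (rename s v'))).
  by rewrite !eval_rename; apply/sle_below/sat_qv.
by apply/eval_leP => n /(fsubsetP vX)/valid_setP[_]; apply.
Qed.

Hypothesis no_tau : ~~ H f_tau.

Lemma valid_closed_rules : closed_rules H X.
Proof.
move=> f s Hf; have nt := not_tau no_tau Hf.
apply: (valid_absorption (absorption_F25 nt)) => A [_ /(_ _ Hf) fA _ _].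
have [<-//|[x [_ Ef]]] := identityE nt.
by move=> e; have := fA e; rewrite Ef /= => ->; apply: addxx.
Qed.

(** A walk of length [2 * n] between the two marks is the image of the path in [gamma n] or
    [gammaD n], whose query then yields the new edge. *)
Lemma valid_closed_dist : closed_dist p q X.
Proof.
have [nz eX] := (closed_envP X).1 valid_closed_env.
move=> x x' y mx mx' /same_classE sxx' [w [pw lw sw]] ex'y.
(* The walk bounding the distance need not be the one witnessing the common class; were it odd, the
   two would close up to an odd walk. *)
have ew : ~~ odd (size w).
  apply/negP => ow; apply: nz; apply: Or33; apply: (@odd_walk_cycle _ x).
  have w1 : walk X true x x' by exists w.
  exact: walk_trans w1 (walk_sym sxx').
have Ew : size w = 2 * (size w)./2.
  by rewrite mul2n -{1}(odd_double_half (size w)) (negPf ew).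
set n := (size w)./2 in Ew.
(* For length zero, [x] equals [x'] and the edge is already present; the identities start at
   [n = 1]. *)
have [n0|n_gt0] := posnP n.
  move: lw Ew; rewrite n0; case: (w) => //= -> _.
  by case/andP: ex'y.
(* The letters up to [2 * n] follow the walk, and the next three go to [y], [a] and [b], where [a]
   and [b] are the arguments of the D-summand. *)
pose s a b j := if j <= 2 * n then nth x (x :: w) j
  else nth 0 [:: y; a; b] (j - (2 * n).+1).
have sE a b : [/\ s a b 0 = x, s a b (2 * n) = x', s a b (2 * n).+1 = y,
    s a b (2 * n).+2 = a & s a b (2 * n).+3 = b].
  rewrite /s leqnn ltnn; split=> //.
  - by rewrite -lw (last_nth x) Ew.
  - by rewrite subnn.
  - by rewrite ltnNge leqnSn /= subSnn.
  by rewrite ltnNge (leq_trans (leqnSn _)) ?leqnSn //= -addn2 addKn.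
have gX a b : mons (rename (s a b) (gamma_rhs n)) `<=` X.
  have [s0 sn sy _ _] := sE a b.
  apply/gamma_rhs_sub; rewrite s0 sn sy; split; [by case: mx | by case: mx' | |
    by case/andP: ex'y].
  move=> j jn; rewrite /s (ltnW jn) jn /=.
  by have /(pathP x)/(_ j) := pw; rewrite Ew => /(_ jn) /andP[].
have res a b : mons (rename (s a b) (gamma_query n)) `<=` X -> [mset x;
  y]%mset \in X.
  by have [s0 _ sy _ _] := sE a b; rewrite mons_renameVV s0 sy fsub1set.
(* In a D-component the opposite marks [a] and [b] are adjacent by [eX] and supply the D-summand.
   Otherwise [gamma n] is used and they get the dummy value 0. *)
move: sw; case: asboolP => [[a [b [ma mb oab]]]|_] sw.
  have nq : nat_le_thr n q by case: (q) sw => //= k; rewrite Ew leq_mul2l.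
  apply: (res a b); apply: (valid_absorption (absorption_gammaD n)).
    by move=> A [_ _ _ gD]; apply: gD.
  rewrite fsubUset gX; apply/tD_sub; have [_ _ _ -> ->] := sE a b.
  by split; [case: ma | case: mb | apply: eX].
have np : nat_le_thr n p by case: (p) sw => //= k; rewrite Ew leq_mul2l.
apply: (res 0 0); apply: (valid_absorption (absorption_gamma n)) => //.
by move=> A [_ _ gA _]; apply: gA.
Qed.

End NonZero.

Hypothesis pq : thr_le p q.
Hypothesis no_tau : ~~ H f_tau.

Lemma valid_closed_ext v : closed_ext H p q (mons v) (valid_nf v).
Proof.
rewrite /valid_nf; case: asboolP => [all0|nz].
  by split=> //; case: (env (mons v)).
split.
- apply/fsubsetP => i /varsP[m /valid_setP[/candidates_sub[_ h] _]]; exact: h.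
- exact: closed_env_le (valid_closed_env nz) (mons_sub_valid nz).
split; [exact: valid_closed_rules | exact: valid_closed_dist | exact:
  valid_closed_env].
Qed.

Lemma nform_sound u v (A : aiSemiring) (e : nat -> A) : subvariety H p q A ->
  nf_le (Some (mons u)) (nform H p q v) -> sle (eval e u) (eval e v).
Proof.
move=> sA uv; have [_ least] := nformP v pq no_tau.
have := nf_le_trans uv (least _ (valid_closed_ext v)).
rewrite /valid_nf; case: asboolP => [all0 _|_ /fsubsetP uX];
  apply/eval_leP => m mu.
  by apply: all0 => //; apply: mons_size mu.
by have /valid_setP[_] := uX _ mu; apply.
Qed.

End Soundness.

(** * Quotients of the term algebra and Birkhoff's argument *)

Lemma mons_mulC s t : mons (Mul s t) = mons (Mul t s).
Proof.
have sub s' t' : {subset mons (Mul s' t') <= mons (Mul t' s')}.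
  by move=> m /mons_mulP[n1 [n2 [? ? ->]]]; rewrite msetDC; apply: mem_mul.
by apply/fsetP => m; apply/idP/idP; apply: sub.
Qed.

Lemma mons_mulA s t u : mons (Mul s (Mul t u)) = mons (Mul (Mul s t) u).
Proof.
apply/fsetP => m; apply/idP/idP => /mons_mulP.
  case=> n1 [_ [h1 /mons_mulP[n2 [n3 [h2 h3 ->]]] ->]]; rewrite msetDA.
  by do 2?apply: mem_mul.
case=> _ [n3 [/mons_mulP[n1 [n2 [h1 h2 ->]]] h3 ->]]; rewrite -msetDA.
by do 2?apply: mem_mul.
Qed.

Lemma mons_mulDr s t u :
  mons (Mul s (Add t u)) = mons (Add (Mul s t) (Mul s u)).
Proof.
apply/fsetP => m; rewrite mons_add; apply/idP/orP.
  case/mons_mulP=> n1 [n2 [h1 + ->]].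
  by rewrite mons_add => /orP[]; [left|right]; apply: mem_mul.
by case=> /mons_mulP[n1 [n2 [h1 h2 ->]]]; apply: mem_mul;
  rewrite // mons_add h2 ?orbT.
Qed.

Section Quotient.
Variables (K : Type) (k : term -> K).
Hypothesis k_mons : forall s t, mons s = mons t -> k s = k t.
Hypothesis k_add : forall s s' t t',
  k s = k s' -> k t = k t' -> k (Add s t) = k (Add s' t').
Hypothesis k_mul : forall s s' t t',
  k s = k s' -> k t = k t' -> k (Mul s t) = k (Mul s' t').

(** The quotient by the kernel of [k] is realised as the image of [k], so that equality of classes
    is equality of values. *)
Definition quot := {x : K | exists t, k t = x}.

Definition class (t : term) : quot := exist _ (k t) (ex_intro _ t erefl).

Definition repr (x : quot) : term := sval (cid (svalP x)).

Lemma k_repr x : k (repr x) = sval x.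
Proof. exact: svalP (cid (svalP x)). Qed.

Lemma class_eq s t : k s = k t -> class s = class t.
Proof. by move=> st; apply: eq_exist. Qed.

Lemma reprK x : class (repr x) = x.
Proof. by case: x => x h; apply: eq_exist; rewrite k_repr. Qed.

Let qadd x y := class (Add (repr x) (repr y)).
Let qmul x y := class (Mul (repr x) (repr y)).

Let qaddE s t : qadd (class s) (class t) = class (Add s t).
Proof. by apply: class_eq; apply: k_add; rewrite k_repr. Qed.

Let qmulE s t : qmul (class s) (class t) = class (Mul s t).
Proof. by apply: class_eq; apply: k_mul; rewrite k_repr. Qed.

Let class_mons s t : mons s = mons t -> class s = class t.
Proof. by move=> st; apply/class_eq/k_mons. Qed.

Let qaddA : associative qadd.
Proof.
move=> x y z; rewrite -(reprK x) -(reprK y) -(reprK z) !qaddE.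
by apply: class_mons; rewrite /= fsetUA.
Qed.

Let qaddC : commutative qadd.
Proof.
move=> x y; rewrite -(reprK x) -(reprK y) !qaddE.
by apply: class_mons; rewrite /= fsetUC.
Qed.

Let qaddxx : idempotent_op qadd.
Proof.
by move=> x; rewrite -(reprK x) !qaddE; apply: class_mons; rewrite /= fsetUid.
Qed.

Let qmulA : associative qmul.
Proof.
move=> x y z; rewrite -(reprK x) -(reprK y) -(reprK z) !qmulE.
exact/class_mons/mons_mulA.
Qed.

Let qmulC : commutative qmul.
Proof.
move=> x y; rewrite -(reprK x) -(reprK y) !qmulE.
exact/class_mons/mons_mulC.
Qed.

Let qmulDr : right_distributive qmul qadd.
Proof.
move=> x y z; rewrite -(reprK x) -(reprK y) -(reprK z) ?(qmulE, qaddE).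
exact/class_mons/mons_mulDr.
Qed.

Definition quotS : aiSemiring :=
  AiSemiring qaddA qaddC qaddxx qmulA qmulC qmulDr.

Lemma class_add s t : class (Add s t) = add (class s : quotS) (class t).
Proof. by rewrite -qaddE. Qed.

Lemma class_mul s t : class (Mul s t) = mul (class s : quotS) (class t).
Proof. by rewrite -qmulE. Qed.

Lemma eval_quot (s : nat -> term) t :
  eval (fun i => class (s i) : quotS) t = class (subst s t).
Proof.
by elim: t => //= t1 IH1 t2 IH2; rewrite IH1 IH2 ?class_add ?class_mul.
Qed.

(** Choosing representatives turns every valuation in the quotient into a substitution. *)
Lemma sat_quot (i : term * term) :
  (forall s, k (subst s i.1) = k (subst s i.2)) -> sat quotS i.
Proof.
move=> ki e.
have -> : e = fun j => class (repr (e j)).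
  by apply: functional_extensionality_dep => j; rewrite reprK.
by rewrite !eval_quot; apply: class_eq.
Qed.

(** The generic valuation, sending each variable to its class, sends a term to its own class. *)
Lemma quot_sat (s t : term) : sat quotS (s, t) -> k s = k t.
Proof.
move=> /(_ (fun i => class (Var i))); rewrite !eval_quot /=.
have E u : subst Var u = u by elim: u => //= u1 -> u2 ->.
by rewrite !E => -[].
Qed.

End Quotient.

Section FreeQuotient.
Variables (K : Type) (k : term -> K).
Hypothesis k_mons : forall s t, mons s = mons t -> k s = k t.
Hypothesis k_add : forall s s' t t',
  k s = k s' -> k t = k t' -> k (Add s t) = k (Add s' t').
Hypothesis k_mul : forall s s' t t',
  k s = k s' -> k t = k t' -> k (Mul s t) = k (Mul s' t').
Variable R : aiSemiring.
Hypothesis k_R : forall s t,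
  (forall e : nat -> R, eval e s = eval e t) -> k s = k t.

(** All values in [R] at once: the kernel of [ev] is the equational theory of [R]. *)
Let ev (t : term) (e : nat -> R) : R := eval e t.

Let ev_mons s t : mons s = mons t -> ev s = ev t.
Proof.
by move=> st; apply: functional_extensionality_dep => e; apply: eval_mons.
Qed.

Let ev_add s s' t t' : ev s = ev s' -> ev t = ev t' ->
  ev (Add s t) = ev (Add s' t').
Proof.
move=> Es Et; apply: functional_extensionality_dep => e.
by rewrite /ev /= -!/(ev _ e) Es Et.
Qed.

Let ev_mul s s' t t' : ev s = ev s' -> ev t = ev t' ->
  ev (Mul s t) = ev (Mul s' t').
Proof.
move=> Es Et; apply: functional_extensionality_dep => e.
by rewrite /ev /= -!/(ev _ e) Es Et.
Qed.

(* The free algebra of the variety, seen inside a power of [R], maps onto the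
   quotient: this is Birkhoff's argument. *)
Lemma quot_variety : variety R (quotS k_mons k_add k_mul).
Proof.
pose F := quotS ev_mons ev_add ev_mul.
have vF : variety R F.
  apply: (variety_sub (A := prodS (fun _ : nat -> R => R))
            (f := fun x : F => sval x)); last 2 first.
  - by move=> [x hx] [y hy] /= xy; apply: eq_exist.
  - by apply: variety_prod => _; apply: variety_gen.
  by split=> x y /=; apply: functional_extensionality_dep => e /=;
    rewrite /ev /= -!/(ev _ e) !k_repr.
pose f (x : F) : quotS k_mons k_add k_mul := class k (repr x).
have fE t : f (class ev t) = class k t.
  apply: class_eq; apply: k_R => e.
  by have := k_repr (class ev t) => /= /(congr1 (fun g => g e)).
apply: (variety_hom (A := F) (f := f)) vF.
  split=> x y; rewrite -(reprK x) -(reprK y).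
    by rewrite -class_add !fE class_add.
  by rewrite -class_mul !fE class_mul.
by move=> y; exists (class ev (repr y)); rewrite fE reprK.
Qed.

End FreeQuotient.

(** * Completeness: the algebra of normal forms as countermodel *)

Section Completeness.
Variables (H : pred F25) (p q : threshold).
Hypothesis pq : thr_le p q.
Hypothesis no_tau : ~~ H f_tau.

Let nform_mul s s' t t' :
  nform H p q s = nform H p q s' -> nform H p q t = nform H p q t' ->
  nform H p q (Mul s t) = nform H p q (Mul s' t').
Proof.
move=> /(nform_mul_l pq no_tau t) -> tt'.
rewrite (nform_mons _ _ _ (mons_mulC s' t)) (nform_mul_l pq no_tau s' tt').
exact/nform_mons/mons_mulC.
Qed.

Definition term_algebra : aiSemiring :=
  quotS (@nform_mons H p q) (nform_add pq no_tau) nform_mul.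

Lemma subvariety_term_algebra : subvariety H p q term_algebra.
Proof.
split.
- by apply: quot_variety; apply: r12_nform.
- by move=> f Hf; apply: sat_quot => s; apply: identity_nform.
- move=> n n_gt0 np; apply: sat_quot => s; apply/nform_below => //.
  apply: (absorption_nform pq no_tau s (absorption_gamma n)).
  by move=> X r cX; apply: (closed_gamma pq cX n_gt0 np).
move=> n n_gt0 nq; apply: sat_quot => s; apply/nform_below => //.
apply: (absorption_nform pq no_tau s (absorption_gammaD n)).
by move=> X r cX; apply: (closed_gammaD cX n_gt0 nq).
Qed.

Lemma nform_complete u v :
  models (subvariety H p q) (u, v) -> nform H p q u = nform H p q v.
Proof. by move=> /(_ _ subvariety_term_algebra)/quot_sat. Qed.

End Completeness.

Theorem theorem5p1 (H : pred F25) (p q : threshold) (hpq : thr_le p q) :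
  (forall u v : term,
     models (subvariety H p q) (u, v) <-> nform H p q u = nform H p q v) /\
  (forall (w v : term) (m : mon), mons w = [fset m]%fset ->
     (models (subvariety H p q) (below w v) <->
      nform H p q v = None \/
      exists2 X, nform H p q v = Some X & m \in X)).
Proof.
have [tau|no_tau] := boolP (H f_tau).
  have nE v : nform H p q v = None by rewrite /nform tau.
  have all_eq u v : models (subvariety H p q) (u, v).
    move=> A [_ sH _ _] e.
    (* Variables 6 and 7 are the [x] and [y] of the identity [f_tau]; they are sent to the values of
       [u] and [v]. *)
    exact: (sH _ tau (fun i => if i == 6 then eval e u else eval e v)).
  split=> [u v|w v m _]; first by rewrite !nE.
  by split=> _; [left | apply: all_eq].
have le_models u v : models (subvariety H p q) (below u v) <->
    nf_le (Some (mons u)) (nform H p q v).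
  split=> [/(nform_complete hpq no_tau)/nform_below|uv A sA e]; first exact.
  by apply/sle_below; apply: nform_sound uv.
split=> [u v|w v m Ew].
  split; first exact: nform_complete.
  move=> uv A sA e; apply: (@sle_anti A).
    by apply: (nform_sound hpq no_tau e sA); rewrite -uv; apply: mons_le_nform.
  by apply: (nform_sound hpq no_tau e sA); rewrite uv; apply: mons_le_nform.
rewrite le_models Ew -/(mon_le m _) mon_leE; case: (nform H p q v) => [X|].
  by split=> [mX|[//|[_ [<-]]]] //; right; exists X.
by split=> // _; left.
Qed.
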